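(* Let $(G,\Lambda,\varphi)$ be a self-similar $k$-graph over a finitely aligned $k$-graph $\Lambda$ and let $\Lambda\rtimes^{\varphi}G$ be its Zappa–Szép product. Then the map $$[\{(\mu,g,\nu)\},\nu x]\longmapsto[\tau^{(\mu,g)}\sigma^{(\nu,e_G)};\nu x]$$ (where $\mu,\nu\in\Lambda$, $g\in G$, $s(\mu)=g\cdot s(\nu)$, $x\in\partial\Lambda$, $r(x)=s(\nu)$) is a groupoid isomorphism from $\mathcal{G}_{\mathrm{tight}}(\mathcal{S}_{G,\Lambda})$ onto $\mathcal{G}_{\mathrm{tight}}(\mathcal{S}(\Lambda\rtimes^{\varphi}G))$.
   Context: **$k$-graphs.** A $k$-graph is a countable small category $\Lambda$ with a functor $d:\Lambda\to\mathbb{N}^k$ (degree) with the unique factorisation property: if $d(\lambda)=m+n$ there are unique $\mu,\nu$ with $d(\mu)=m$, $d(\nu)=n$, $\lambda=\mu\nu$. $\Lambda^0=d^{-1}(0)$ is identified with the objects (vertices); $r,s$ are range and source, and $\mu\nu$ is defined iff $s(\mu)=r(\nu)$. $v\Lambda=\{\lambda:r(\lambda)=v\}$. With $\vee$ the coordinatewise maximum, $\Lambda^{\min}(\mu,\nu)=\{(\alpha,\beta):\mu\alpha=\nu\beta,\ d(\mu\alpha)=d(\mu)\vee d(\nu)\}$. $\Lambda$ is finitely aligned if all $\Lambda^{\min}(\mu,\nu)$ are finite. $v\mathbf{FE}(\Lambda)$ is the collection of finite sets $X\subseteq v\Lambda\setminus\{v\}$ that are exhaustive: for every $\mu\in v\Lambda$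 there is $\nu\in X$ with $\Lambda^{\min}(\mu,\nu)\ne\emptyset$. **Self-similar $k$-graph** $(G,\Lambda,\varphi)$: a finitely aligned $k$-graph $\Lambda$, a countable discrete group $G$ with identity $e_G$, an action of $G$ on $\Lambda$ by degree-preserving bijections commuting with $r$ and $s$, and a map $\varphi:G\times\Lambda\to G$ such that for all $g,h\in G$, $\mu,\nu\in\Lambda$ (with $s(\mu)=r(\nu)$ where $\mu\nu$ occurs), $v\in\Lambda^0$: $\varphi(gh,\mu)=\varphi(g,h\cdot\mu)\varphi(h,\mu)$; $g\cdot(\mu\nu)=(g\cdot\mu)(\varphi(g,\mu)\cdot\nu)$; $\varphi(g,\mu\nu)=\varphi(\varphi(g,\mu),\nu)$; $\varphi(g,v)=g$. **$\mathcal{S}_{G,\Lambda}$**: elements are the finite sets $F$ of triples $(\mu,g,\nu)\in\Lambda\times G\times\Lambda$ with $s(\mu)=g\cdot s(\nu)$, such that any two distinct triples $(\mu,g,\nu),(\xi,h,\eta)\in F$ satisfy $\Lambda^{\min}(\mu,\xi)=\Lambda^{\min}(\nu,\eta)=\emptyset$. Multiplication: $EF=\bigcup_{(\mu,g,\nu)\in E,(\xi,h,\eta)\in F}\{(\mu(g\cdot\alpha),\varphi(g,\alpha)\varphi(h,h^{-1}\cdot\beta),\eta(h^{-1}\cdot\beta)):(\alpha,\beta)\in\Lambda^{\min}(\nu,\xi)\}$; $F^*=\{(\nu,g^{-1},\mu):(\mu,g,\nu)\in F\}$; zero is $\emptyset$. It is an inverse semigroup with zero. **Zappa–Szép product.**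 $\Lambda\rtimes^\varphi G=\Lambda\times G$ is the small category with objects $\Lambda^0\times\{e_G\}$, $r(\mu,g)=(r(\mu),e_G)$, $s(\mu,g)=(g^{-1}\cdot s(\mu),e_G)$ and composition $(\mu,g)(\nu,h)=(\mu(g\cdot\nu),\varphi(g,\nu)h)$. It is left cancellative. For a left cancellative small category $\mathfrak{C}$ and $\alpha\in\mathfrak{C}$ let $\tau^\alpha:s(\alpha)\mathfrak{C}\to\alpha\mathfrak{C}$, $\beta\mapsto\alpha\beta$, and $\sigma^\alpha=(\tau^\alpha)^{-1}$. $\mathcal{S}(\mathfrak{C})$ is the inverse semigroup generated by all $\sigma^\alpha,\tau^\alpha$ inside the symmetric inverse semigroup of partial bijections of $\mathfrak{C}$. **Tight groupoid.** Let $S$ be an inverse semigroup with $0$, $\mathcal{E}(S)$ its idempotent semilattice with order $e\le f\iff ef=e$. A filter is a nonempty subset of $\mathcal{E}(S)$ closed under products and upward closed; $\widehat{\mathcal{E}}_0(S)$ is the set of filters not containing $0$, topologised by the sets $\{\mathcal{F}:e\in\mathcal{F},e_1,\dots,e_n\notin\mathcal{F}\}$. The tight spectrum $\widehat{\mathcal{E}}_{\mathrm{tight}}(S)$ is the closure in $\widehat{\mathcal{E}}_0(S)$ of the set of ultrafilters (maximal elements of $\widehat{\mathcal{E}}_0(S)$). For $s\in S$, $\theta_s$ is defined on tight filters containing $s^*s$ by $\theta_s(\mathcal{F})=\{f\in\mathcal{E}(S):f\ge ses^*\text{ for some }e\in\mathcal{F}\}$. $\mathcal{G}_{\mathrm{tight}}(S)$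 is the groupoid of germs $[s,\mathcal{F}]$ ($s^*s\in\mathcal{F}$), with $[s,\mathcal{F}]=[t,\mathcal{F}']$ iff $\mathcal{F}=\mathcal{F}'$ and $se=te$ for some $e\in\mathcal{F}$; $[t,\theta_s(\mathcal{F})][s,\mathcal{F}]=[ts,\mathcal{F}]$, $[s,\mathcal{F}]^{-1}=[s^*,\theta_s(\mathcal{F})]$; its topology is generated by the sets $\{[s,\mathcal{F}]:\mathcal{F}\in U\}$ with $U$ open in the domain of $\theta_s$. **Boundary paths and identifications.** For $m\in(\mathbb{N}\cup\{\infty\})^k$, $\Omega_{k,m}=\{(p,q)\in\mathbb{N}^k\times\mathbb{N}^k:p\le q\le m\}$ is the $k$-graph with $r(p,q)=(p,p)$, $s(p,q)=(q,q)$, $d(p,q)=q-p$. A boundary path is a degree-preserving functor $x:\Omega_{k,m}\to\Lambda$ such that for all $p\in\mathbb{N}^k$, $p\le m$, and $X\in x(p)\mathbf{FE}(\Lambda)$ there is $\mu\in X$ with $x(p,p+d(\mu))=\mu$; $x(p)=x(p,p)$, $d(x)=m$, $r(x)=x(0)$. $\partial\Lambda$ is the set of boundary paths. The tight spectra of both inverse semigroups are identified with $\partial\Lambda$: for $\mathcal{S}_{G,\Lambda}$, $x$ corresponds to the filter of idempotents $E$ with $(x(0,n),e_G,x(0,n))\in E$ for some $n\le d(x)$; for $\mathcal{S}(\Lambda\rtimes^\varphi G)$, whose idempotents are identity maps on certain subsets of $\Lambda\rtimes^\varphi G$, $x$ corresponds to the filter of idempotents whose domain contains $(x(0,n),e_G)$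 for some $n\le d(x)$. Under this identification every element of $\mathcal{G}_{\mathrm{tight}}(\mathcal{S}_{G,\Lambda})$ can be written as $[\{(\mu,g,\nu)\},\nu x]$ with $s(\mu)=g\cdot s(\nu)$, $r(x)=s(\nu)$. *)

(* Defs.v *)
From HB Require Import structures.
From mathcomp Require Import all_boot.
From mathcomp Require Import boolp classical_sets functions cardinality.
From mathcomp Require Import topology.

Set Implicit Arguments.
Unset Strict Implicit.
Unset Printing Implicit Defensive.

Local Open Scope classical_set_scope.

Record invSemigroup0 := InvSemigroup0 {
  isg :> Type;
  ismul : isg -> isg -> isg;
  isstar : isg -> isg;
  iszero : isg;
  ismulA : forall a b c, ismul a (ismul b c) = ismul (ismul a b) c;
  ismul_star : forall a, ismul (ismul a (isstar a)) a = a;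
  isstar_mul : forall a, ismul (ismul (isstar a) a) (isstar a) = isstar a;
  isidemC : forall e f, ismul e e = e -> ismul f f = f -> ismul e f = ismul f e;
  ismul0s : forall a, ismul iszero a = iszero;
  ismuls0 : forall a, ismul a iszero = iszero
}.

Section Idempotents.
Variable S : invSemigroup0.
Definition idem : set S := [set e | ismul e e = e].
Definition idem_le (e f : S) : Prop := ismul e f = e.
End Idempotents.

(* [f x y] means that the partial bijection f maps x to y. *)
Record pbij (X : Type) := Pbij {
  pbrel :> X -> X -> Prop;
  pb_fun : forall x y z, pbrel x y -> pbrel x z -> y = z;
  pb_inj : forall x y z, pbrel x z -> pbrel y z -> x = y
}.

Section PartialBijections.
Variable X : Type.
Implicit Types f g h : pbij X.

Lemma pbijP f g : (forall x y, f x y <-> g x y) -> f = g.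
Proof.
case: f g => [f ff fi] [g gf gi] /= fg.
have e : f = g by apply/funext => x; apply/funext => y; apply/propext/fg.
by subst g; congr Pbij; exact: Prop_irrelevance.
Qed.

Definition pbcomp f g : pbij X.
Proof.
exists (fun x z => exists2 y, g x y & f y z).
- move=> x y z [u gu fu] [v gv fv]; rewrite (pb_fun gv gu) in fv.
  exact: pb_fun fu fv.
- move=> x y z [u gu fu] [v gv fv]; rewrite (pb_inj fu fv) in gu.
  exact: pb_inj gu gv.
Defined.

Definition pbinv f : pbij X.
Proof.
exists (fun x y => f y x).
- by move=> x y z; exact: pb_inj.
- by move=> x y z; exact: pb_fun.
Defined.

Definition pbempty : pbij X.
Proof. by exists (fun _ _ => False). Defined.

Lemma pbcompA f g h : pbcomp f (pbcomp g h) = pbcomp (pbcomp f g) h.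
Proof.
apply: pbijP => x y; split=> /=.
- by move=> [z [u hu gu] fz]; exists u => //; exists z.
- by move=> [u hu [z gu fz]]; exists z => //; exists u.
Qed.

Lemma pbinvK f : pbinv (pbinv f) = f.
Proof. exact: pbijP. Qed.

Lemma pbcompfVf f : pbcomp (pbcomp f (pbinv f)) f = f.
Proof.
apply: pbijP => x y; split=> /=.
- by move=> [u fxu [v fvu fvy]]; rewrite (pb_inj fxu fvu).
- by move=> fxy; exists y => //; exists x.
Qed.

Lemma pbidem_id f x y : pbcomp f f = f -> f x y -> x = y.
Proof.
move=> ff fxy; have := fxy; rewrite -{1}ff /= => -[z fxz fzy].
by rewrite -(pb_fun fxy fxz) in fzy; exact: pb_inj fxy fzy.
Qed.

Lemma pbidemC f g : pbcomp f f = f -> pbcomp g g = g ->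
  pbcomp f g = pbcomp g f.
Proof.
move=> ff gg; apply: pbijP => x y; split=> /= -[z].
- move=> gxz fzy; move: (pbidem_id gg gxz) (pbidem_id ff fzy) => ? ?; subst.
  by exists y.
- move=> fxz gzy; move: (pbidem_id ff fxz) (pbidem_id gg gzy) => ? ?; subst.
  by exists y.
Qed.

Section Embedded.
Variables (T : Type) (mul : T -> T -> T) (star : T -> T) (zero : T).
Variable rho : T -> pbij X.
Hypothesis rho_inj : forall a b, rho a = rho b -> a = b.
Hypothesis rhoM : forall a b, rho (mul a b) = pbcomp (rho a) (rho b).
Hypothesis rhoV : forall a, rho (star a) = pbinv (rho a).
Hypothesis rho0 : rho zero = pbempty.

Definition embeddedInvSemigroup0 : invSemigroup0.
Proof.
refine (@InvSemigroup0 T mul star zero _ _ _ _ _ _).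
- by move=> a b c; apply: rho_inj; rewrite !rhoM pbcompA.
- by move=> a; apply: rho_inj; rewrite !rhoM rhoV pbcompfVf.
- move=> a; apply: rho_inj; rewrite !rhoM rhoV.
  by rewrite -{2}(pbinvK (rho a)) pbcompfVf.
- move=> e f ee ff; apply: rho_inj; rewrite !rhoM pbidemC // -rhoM.
  + by rewrite ee.
  + by rewrite ff.
- move=> a; apply: rho_inj; rewrite rhoM rho0.
  by apply: pbijP => x y; split=> //= -[].
- move=> a; apply: rho_inj; rewrite rhoM rho0.
  by apply: pbijP => x y; split=> //= -[].
Defined.
End Embedded.
End PartialBijections.

Section Tight.
Variable S : invSemigroup0.
Local Notation "a * b" := (ismul a b).
Local Notation "a ^*" := (isstar a).

Record filter0 := Filter0 {
  filter_set : set S;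
  filter_idem : filter_set `<=` @idem S;
  filter_neq0 : filter_set !=set0;
  filter_mul : forall e f, filter_set e -> filter_set f -> filter_set (e * f);
  filter_up : forall e f, filter_set e -> idem f -> idem_le e f -> filter_set f;
  filter_zero : ~ filter_set (iszero S)
}.

HB.instance Definition _ := gen_eqMixin filter0.
HB.instance Definition _ := gen_choiceMixin filter0.

Definition filter0_subbase : set (set filter0) :=
  [set B | exists (e : S) (X : set S), [/\ idem e, finite_set X, X `<=` @idem S
     & B = [set F : filter0 | filter_set F e /\
                               forall f, X f -> ~ filter_set F f]]].

HB.instance Definition _ :=
  @isSubBaseTopological.Build filter0 (set filter0) filter0_subbase id.

Definition ultrafilters : set filter0 :=
  [set F | forall F' : filter0, 
     filter_set F `<=` filter_set F' -> F = F'].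

Definition tight_spectrum : set filter0 := closure ultrafilters.

Definition is_tight (F : set S) : Prop :=
  exists2 F' : filter0, tight_spectrum F' & F = filter_set F'.

Definition theta (s : S) (F : set S) : set S :=
  [set f | idem f /\ exists2 e, F e & idem_le (s * e * s^*) f].

(* The germ [s, F], as the equivalence class of all pairs (t, F). *)
Definition germ_class (s : S) (F : set S) : set (S * set S) :=
  [set p | [/\ p.2 = F, F (p.1^* * p.1) & exists2 e, F e & s * e = p.1 * e]].

Record tightGroupoid := TightGroupoid {
  germ_val : set (S * set S);
  germ_valP : exists s F,
    [/\ is_tight F, F (s^* * s) & germ_val = germ_class s F]
}.

(* "c = [s, F]", including that [s, F] is an element of the groupoid *)
Definition is_germ (c : tightGroupoid) (s : S) (F : set S) : Prop :=
  [/\ is_tight F, F (s^* * s) & germ_val c = germ_class s F].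

(* "(c1, c2) is composable and c1 c2 = c3" *)
Definition germ_mul (c1 c2 c3 : tightGroupoid) : Prop :=
  exists t s F, [/\ is_germ c1 t (theta s F), is_germ c2 s F
                  & is_germ c3 (t * s) F].

(* "c^-1 = c'" *)
Definition germ_inv (c c' : tightGroupoid) : Prop :=
  exists s F, is_germ c s F /\ is_germ c' s^* (theta s F).

HB.instance Definition _ := gen_eqMixin tightGroupoid.
HB.instance Definition _ := gen_choiceMixin tightGroupoid.

(* An open subset of the domain of theta_s is the trace of an open set V of
   filters on the tight filters containing s^* s. *)
Definition tightGroupoid_subbase : set (set tightGroupoid) :=
  [set B | exists (s : S) (V : set filter0), open V /\
     B = [set c | exists2 F : filter0, V F & is_germ c s (filter_set F)]].

HB.instance Definition _ :=
  @isSubBaseTopological.Build tightGroupoid (set tightGroupoid)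
    tightGroupoid_subbase id.

End Tight.

(* [germ_mul] is the graph of the partial product, so the first clause also
   says that Phi preserves and reflects composability. *)
Definition tightGroupoid_iso (S T : invSemigroup0)
    (Phi : tightGroupoid S -> tightGroupoid T) : Prop :=
  [/\ forall c1 c2 c3,
        germ_mul c1 c2 c3 <-> germ_mul (Phi c1) (Phi c2) (Phi c3),
      forall c c', germ_inv c c' <-> germ_inv (Phi c) (Phi c')
    & exists Psi : tightGroupoid T -> tightGroupoid S,
      [/\ cancel Phi Psi, cancel Psi Phi, continuous Phi & continuous Psi]].

(* A small category presented by its morphisms, the objects being identified
   with the identity morphisms.  [cmp a b] is meaningful only when
   [sc a = rg b]; its other values are junk, so composability is always
   required explicitly. *)
Record category := Category {
  mor :> choiceType;
  rg : mor -> mor;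
  sc : mor -> mor;
  cmp : mor -> mor -> mor;
  rg_rg : forall a, rg (rg a) = rg a;
  sc_rg : forall a, sc (rg a) = rg a;
  rg_sc : forall a, rg (sc a) = sc a;
  sc_sc : forall a, sc (sc a) = sc a;
  rg_cmp : forall a b, sc a = rg b -> rg (cmp a b) = rg a;
  sc_cmp : forall a b, sc a = rg b -> sc (cmp a b) = sc b;
  cmp_rg : forall a, cmp (rg a) a = a;
  cmp_sc : forall a, cmp a (sc a) = a;
  cmpA : forall a b c, sc a = rg b -> sc b = rg c ->
    cmp a (cmp b c) = cmp (cmp a b) c
}.

Definition is_object (C : category) (v : C) : Prop := rg v = v.

Record lcCategory := LcCategory {
  lccat :> category;
  lc_cancel : forall a b c : lccat, sc a = rg b -> sc a = rg c ->
    cmp a b = cmp a c -> b = c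
}.

Section LeftCancellative.
Variable C : lcCategory.

Definition tau_pb (a : C) : pbij C.
Proof.
exists (fun b c => sc a = rg b /\ c = cmp a b).
- by move=> x y z [_ ->] [_ ->].
- by move=> x y z [ax ->] [ay]; exact: lc_cancel.
Defined.

Definition sigma_pb (a : C) : pbij C := pbinv (tau_pb a).

(* The empty map is put among the generators in order to have a zero also
   when the maps tau and sigma do not produce one (e.g. if C is a group);
   filters not containing 0 and their germs do not see the difference. *)
Inductive in_SC : pbij C -> Prop :=
| SC_tau a : in_SC (tau_pb a)
| SC_sigma a : in_SC (sigma_pb a)
| SC_zero : in_SC (pbempty C)
| SC_mul f g : in_SC f -> in_SC g -> in_SC (pbcomp f g)
| SC_inv f : in_SC f -> in_SC (pbinv f).

Record SC_elt := SCElt { SC_val :> pbij C; SC_valP : in_SC SC_val }.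

Lemma SC_val_inj (f g : SC_elt) : SC_val f = SC_val g -> f = g.
Proof.
case: f g => [f fP] [g gP] /= e; subst g.
by congr SCElt; exact: Prop_irrelevance.
Qed.

Definition SC : invSemigroup0 :=
  @embeddedInvSemigroup0 C SC_elt
    (fun f g => SCElt (SC_mul (SC_valP f) (SC_valP g)))
    (fun f => SCElt (SC_inv (SC_valP f)))
    (SCElt SC_zero)
    SC_val SC_val_inj (fun _ _ => erefl) (fun _ => erefl) erefl.

Definition tau (a : C) : SC := SCElt (SC_tau a).
Definition sigma (a : C) : SC := SCElt (SC_sigma a).

End LeftCancellative.

Definition dg (k : nat) : Type := 'I_k -> nat.
Definition dg0 {k} : dg k := fun=> 0%N.
Definition dgD {k} (m n : dg k) : dg k := fun i => (m i + n i)%N.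
Definition dgB {k} (m n : dg k) : dg k := fun i => (m i - n i)%N.
Definition dgV {k} (m n : dg k) : dg k := fun i => maxn (m i) (n i).
Definition dgle {k} (m n : dg k) : Prop := forall i, (m i <= n i)%N.

(* (N u {oo})^k, with [None] for oo *)
Definition edg (k : nat) : Type := 'I_k -> option nat.
Definition edgle {k} (n : dg k) (m : edg k) : Prop :=
  forall i, if m i is Some b then (n i <= b)%N else true.
Definition edgD {k} (n : dg k) (m : edg k) : edg k :=
  fun i => omap (addn (n i)) (m i).

Record kgraph (k : nat) := KGraph {
  kcat :> category;
  kgraph_countable : countable [set: kcat];
  deg : kcat -> dg k;
  deg_cmp : forall a b, sc a = rg b -> deg (cmp a b) = dgD (deg a) (deg b);
  unique_factorisation : forall (l : kcat) (m n : dg k), deg l = dgD m n ->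
    exists! p : kcat * kcat,
      [/\ deg p.1 = m, deg p.2 = n, sc p.1 = rg p.2 & l = cmp p.1 p.2]
}.

Section KGraph.
Variables (k : nat) (L : kgraph k).

Definition Lmin (mu nu : L) : set (L * L) :=
  [set p | [/\ sc mu = rg p.1, sc nu = rg p.2, cmp mu p.1 = cmp nu p.2
             & deg (cmp mu p.1) = dgV (deg mu) (deg nu)]].

Definition finitely_aligned : Prop :=
  forall mu nu : L, finite_set (Lmin mu nu).

Definition FE (v : L) : set (set L) :=
  [set X | [/\ finite_set X,
               X `<=` [set mu | rg mu = v /\ mu <> v]
             & forall mu, rg mu = v -> exists2 nu, X nu & Lmin mu nu !=set0]].

(* The data of a functor from Omega_{k,m} to L, with m = [pdeg]; only the
   values [pmor p q] with p <= q <= m are relevant. *)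
Record prepath := Prepath {
  pdeg : edg k;
  pmor : dg k -> dg k -> L
}.

Record is_path (x : prepath) : Prop := {
  path_deg : forall p q, dgle p q -> edgle q (pdeg x) ->
    deg (pmor x p q) = dgB q p;
  path_rg : forall p q, dgle p q -> edgle q (pdeg x) ->
    rg (pmor x p q) = pmor x p p;
  path_sc : forall p q, dgle p q -> edgle q (pdeg x) ->
    sc (pmor x p q) = pmor x q q;
  path_cmp : forall p q t, dgle p q -> dgle q t -> edgle t (pdeg x) ->
    pmor x p t = cmp (pmor x p q) (pmor x q t)
}.

Definition boundary_path (x : prepath) : Prop :=
  is_path x /\
  forall p X, edgle p (pdeg x) -> FE (pmor x p p) X ->
    exists2 mu, X mu & edgle (dgD p (deg mu)) (pdeg x) /\
                       pmor x p (dgD p (deg mu)) = mu.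

Definition path_range (x : prepath) : L := pmor x dg0 dg0.

(* l(p, q) for p <= q <= deg l: the unique b such that l = a b c with
   deg a = p and deg b = q - p *)
Definition segment (l : L) (p q : dg k) : L :=
  xget l [set b | exists a c, [/\ deg a = p, deg b = dgB q p,
                                  sc a = rg b, sc b = rg c
                                & l = cmp a (cmp b c)]].

(* nu x: its segment from p to q is read off in nu x(0, (q v deg nu) - deg nu),
   and (q v deg nu) - deg nu is the truncated difference of q and deg nu. *)
Definition path_concat (nu : L) (x : prepath) : prepath := {|
  pdeg := edgD (deg nu) (pdeg x);
  pmor := fun p q => segment (cmp nu (pmor x dg0 (dgB q (deg nu)))) p q
|}.

Lemma rg_cmpE (a b c : L) : sc a = rg b -> sc b = rg c -> sc a = rg (cmp b c).
Proof. by move=> ab bc; rewrite rg_cmp. Qed.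

Lemma factor_uniq (a b a' b' : L) : sc a = rg b -> sc a' = rg b' ->
  cmp a b = cmp a' b' -> deg a = deg a' -> a = a' /\ b = b'.
Proof.
move=> ab ab' e da.
have db : deg b = deg b'.
  apply/funext => i; have := congr1 (fun l => deg l i) e.
  by rewrite /= !deg_cmp // /dgD da => /addnI.
have [p [_ pu]] := unique_factorisation (deg_cmp ab).
have := pu (a, b) (And4 erefl erefl ab erefl).
rewrite (pu (a', b') (And4 (esym da) (esym db) ab' e)).
by move=> [<- <-].
Qed.

Lemma cmpI (a b c : L) : sc a = rg b -> sc a = rg c -> cmp a b = cmp a c ->
  b = c.
Proof. by move=> ab ac e; case: (factor_uniq ab ac e). Qed.

Lemma factor (l : L) (m : dg k) : dgle m (deg l) ->
  exists a b, [/\ deg a = m, sc a = rg b & l = cmp a b].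
Proof.
move=> ml; have dl : deg l = dgD m (dgB (deg l) m).
  by apply/funext => i; rewrite /dgD /dgB subnKC.
have [[a b] [[/= da _ ab e] _]] := unique_factorisation dl.
by exists a, b.
Qed.

Lemma deg_obj (v : L) : sc v = rg v -> cmp v v = v -> deg v = dg0.
Proof.
move=> vv e; apply/funext => i; have := deg_cmp vv.
move/(congr1 (fun f => f i)); rewrite e /dgD /dg0 => /eqP.
by rewrite -{1}[deg v i]addn0 eqn_add2l eq_sym => /eqP.
Qed.

Lemma deg_sc (a : L) : deg (sc a) = dg0.
Proof.
apply: deg_obj; first by rewrite sc_sc rg_sc.
by rewrite -{2}[sc a]sc_sc cmp_sc.
Qed.

Lemma deg0_sc (a : L) : deg a = dg0 -> sc a = a /\ rg a = a.
Proof.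
move=> da; have d0 : deg (rg a) = dg0.
  by rewrite -[rg a]sc_rg deg_sc.
have e1 : sc (rg a) = rg a by rewrite sc_rg.
have e2 : sc a = rg (sc a) by rewrite rg_sc.
have e3 : cmp (rg a) a = cmp a (sc a) by rewrite cmp_rg cmp_sc.
by have [x <-] := factor_uniq e1 e2 e3 (etrans d0 (esym da)).
Qed.

Lemma common_ext (mu nu a b : L) : sc mu = rg a -> sc nu = rg b ->
  cmp mu a = cmp nu b ->
  exists p y, [/\ Lmin mu nu p, sc p.1 = rg y, sc p.2 = rg y,
                  a = cmp p.1 y & b = cmp p.2 y].
Proof.
move=> ma nb e.
have le : dgle (dgV (deg mu) (deg nu)) (deg (cmp mu a)).
  move=> i; rewrite /dgV geq_max {2}e !deg_cmp // /dgD.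
  by rewrite !leq_addr.
have [l [y [dl ly El]]] := factor le.
have lm : dgle (deg mu) (deg l) by rewrite dl => i; exact: leq_maxl.
have ln : dgle (deg nu) (deg l) by rewrite dl => i; exact: leq_maxr.
have [mu' [a' [dm ma' Em]]] := factor lm.
have [nu' [b' [dn nb' En]]] := factor ln.
have ay : sc a' = rg y by rewrite -ly Em sc_cmp.
have by' : sc b' = rg y by rewrite -ly En sc_cmp.
have E1 : cmp mu a = cmp mu' (cmp a' y) by rewrite El Em cmpA.
have E2 : cmp nu b = cmp nu' (cmp b' y) by rewrite -e El En cmpA.
have [? ?] := factor_uniq ma (rg_cmpE ma' ay) E1 (esym dm).
have [? ?] := factor_uniq nb (rg_cmpE nb' by') E2 (esym dn).
subst mu' a nu' b.
exists (a', b'), y; split=> //; split=> //=.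
- by rewrite -Em -En.
- by rewrite -Em.
Qed.

Lemma Lmin0_ext (mu nu a b : L) : Lmin mu nu = set0 ->
  sc mu = rg a -> sc nu = rg b -> cmp mu a <> cmp nu b.
Proof.
move=> e0 ma nb e; have [p [y [pm _ _ _ _]]] := common_ext ma nb e.
by rewrite e0 in pm.
Qed.

End KGraph.

(* Commuting with [rg] and [sc] makes the action preserve the objects.  The
   first half of [act_cmp] says that the right-hand side of
   g (mu nu) = (g mu) (phi(g, mu) nu) is defined. *)
Record selfSimilar (k : nat) (L : kgraph k) (G : groupType) := SelfSimilar {
  ss_finitely_aligned : finitely_aligned L;
  ss_countable : countable [set: G];
  act : G -> L -> L;
  coc : G -> L -> G;
  act1 : forall mu, act 1%g mu = mu;
  actM : forall g h mu, act (g * h)%g mu = act g (act h mu);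
  deg_act : forall g mu, deg (act g mu) = deg mu;
  rg_act : forall g mu, rg (act g mu) = act g (rg mu);
  sc_act : forall g mu, sc (act g mu) = act g (sc mu);
  cocM : forall g h mu, coc (g * h)%g mu = (coc g (act h mu) * coc h mu)%g;
  act_cmp : forall g mu nu, sc mu = rg nu ->
    sc (act g mu) = rg (act (coc g mu) nu) /\
    act g (cmp mu nu) = cmp (act g mu) (act (coc g mu) nu);
  coc_cmp : forall g mu nu, sc mu = rg nu ->
    coc g (cmp mu nu) = coc (coc g mu) nu;
  coc_obj : forall g v, is_object v -> coc g v = g
}.

Section SelfSimilar.
Variables (k : nat) (L : kgraph k) (G : groupType) (A : selfSimilar L G).
Local Notation act := (act A).
Local Notation coc := (coc A).

Lemma actK g mu : act g^-1%g (act g mu) = mu.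
Proof. by rewrite -actM mulVg act1. Qed.

Lemma actKV g mu : act g (act g^-1%g mu) = mu.
Proof. by rewrite -actM mulgV act1. Qed.

Lemma coc1 mu : coc 1%g mu = 1%g.
Proof.
have := cocM A 1%g 1%g mu; rewrite mulg1 act1 => e.
by apply: (mulgI (coc 1%g mu)); rewrite -e mulg1.
Qed.

Lemma cocV g mu : coc g^-1%g (act g mu) = (coc g mu)^-1%g.
Proof.
apply: (mulIg (coc g mu)).
by rewrite -cocM mulVg coc1 mulVg.
Qed.

Lemma act_cmpE g mu nu : sc mu = rg nu ->
  act g (cmp mu nu) = cmp (act g mu) (act (coc g mu) nu).
Proof. by move=> /(act_cmp A g)[]. Qed.

Lemma sc_act_coc g mu : act g (sc mu) = act (coc g mu) (sc mu).
Proof.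
have [] := @act_cmp _ _ _ A g mu (sc mu); first by rewrite rg_sc.
by rewrite sc_act rg_act rg_sc.
Qed.

Definition zs_rg (a : L * G) : L * G := (rg a.1, 1%g).
Definition zs_sc (a : L * G) : L * G := (act a.2^-1%g (sc a.1), 1%g).
Definition zs_cmp (a b : L * G) : L * G :=
  (cmp a.1 (act a.2 b.1), (coc a.2 b.1 * b.2)%g).

Lemma zs_composable a b : zs_sc a = zs_rg b -> sc a.1 = rg (act a.2 b.1).
Proof. by move=> [e]; rewrite rg_act -e actKV. Qed.

Definition zs_category : category.
Proof.
refine (@Category (L * G)%type zs_rg zs_sc zs_cmp _ _ _ _ _ _ _ _ _).
- by move=> [m g]; rewrite /zs_rg /= rg_rg.
- by move=> [m g]; rewrite /zs_sc /zs_rg /= invg1 act1 sc_rg.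
- by move=> [m g]; rewrite /zs_sc /zs_rg /= rg_act rg_sc.
- by move=> [m g]; rewrite /zs_sc /= invg1 act1 sc_act sc_sc.
- by move=> a b /zs_composable e; rewrite /zs_rg /= rg_cmp.
- move=> [m g] [n h] /zs_composable /= e; rewrite /zs_sc /=; congr pair.
  rewrite sc_cmp // invgM actM; congr act.
  by rewrite sc_act sc_act_coc actK.
- by move=> [m g]; rewrite /zs_cmp /zs_rg /= act1 cmp_rg coc1 mul1g.
- move=> [m g]; rewrite /zs_cmp /zs_sc /= actKV cmp_sc mulg1 coc_obj //.
  by rewrite /is_object rg_act rg_sc.
- move=> [m g] [n h] [l i] e1 e2; have /= c1 := zs_composable e1.
  have /= c2 := zs_composable e2; rewrite /zs_cmp /=; congr pair.
    rewrite (act_cmpE _ c2) actM cmpA //.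
    by case: (act_cmp A g c2).
  by rewrite (coc_cmp A _ c2) cocM mulgA.
Defined.

Definition zappaSzep : lcCategory.
Proof.
apply: (@LcCategory zs_category) => -[m g] [n h] [l i] e1 e2 [].
have /= c1 := zs_composable e1; have /= c2 := zs_composable e2.
move=> /(cmpI c1 c2) /(congr1 (act g^-1%g)); rewrite !actK => ->.
by move=> /mulgI ->.
Defined.

(* ((mu, g), nu) is the triple (mu, g, nu). *)
Definition triple : Type := (L * G * L)%type.

Definition in_SGL (F : set triple) : Prop :=
  [/\ finite_set F,
      forall mu g nu, F (mu, g, nu) -> sc mu = act g (sc nu)
    & forall mu g nu xi h eta, F (mu, g, nu) -> F (xi, h, eta) ->
        (mu, g, nu) <> (xi, h, eta) ->
        Lmin mu xi = set0 /\ Lmin nu eta = set0].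

Definition SGL_mul (E F : set triple) : set triple :=
  [set t | exists mu g nu xi h eta alpha beta,
     [/\ E (mu, g, nu), F (xi, h, eta), Lmin nu xi (alpha, beta)
       & t = (cmp mu (act g alpha),
              (coc g alpha * coc h (act h^-1%g beta))%g,
              cmp eta (act h^-1%g beta))]].

Definition SGL_star (F : set triple) : set triple :=
  [set t | exists mu g nu, F (mu, g, nu) /\ t = (nu, g^-1%g, mu)].

Record SGL_elt := SGLElt {
  SGL_val : set triple;
  SGL_valP : in_SGL SGL_val
}.


Lemma SGL_val_inj (E F : SGL_elt) : SGL_val E = SGL_val F -> E = F.
Proof.
case: E F => [E eP] [F fP] /= e; subst F.
by congr SGLElt; exact: Prop_irrelevance.
Qed.

Lemma SGL_composable (F : set triple) mu g nu y : in_SGL F ->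
  F (mu, g, nu) -> sc nu = rg y -> sc mu = rg (act g y).
Proof. by move=> [_ Fs _] /Fs -> e; rewrite rg_act e. Qed.

Lemma SGL_composableV (F : set triple) mu g nu y : in_SGL F ->
  F (mu, g, nu) -> sc mu = rg y -> sc nu = rg (act g^-1%g y).
Proof.
by move=> [_ Fs _] /Fs e my; rewrite rg_act -my e actK.
Qed.

Lemma SGL_src_eq (F : set triple) mu g nu xi h eta a b : in_SGL F ->
  F (mu, g, nu) -> F (xi, h, eta) -> sc nu = rg a -> sc eta = rg b ->
  cmp nu a = cmp eta b -> (mu, g, nu) = (xi, h, eta).
Proof.
move=> [_ _ Fd] F1 F2 na eb e; apply: contrapT => ne.
by have [_ /Lmin0_ext] := Fd _ _ _ _ _ _ F1 F2 ne; apply; [exact: na|exact: eb|].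
Qed.

Lemma SGL_tgt_eq (F : set triple) mu g nu xi h eta a b : in_SGL F ->
  F (mu, g, nu) -> F (xi, h, eta) -> sc mu = rg a -> sc xi = rg b ->
  cmp mu a = cmp xi b -> (mu, g, nu) = (xi, h, eta).
Proof.
move=> [_ _ Fd] F1 F2 na eb e; apply: contrapT => ne.
by have [/Lmin0_ext+ _] := Fd _ _ _ _ _ _ F1 F2 ne; apply; [exact: na|exact: eb|].
Qed.

(* (mu, g, nu) acts on the Zappa-Szep product as tau^(mu, g) sigma^(nu, e). *)
Definition SGL_rho (F : SGL_elt) : pbij (L * G).
Proof.
exists (fun c c' => exists mu g nu y, [/\ SGL_val F (mu, g, nu), sc nu = rg y,
  c.1 = cmp nu y & c' = (cmp mu (act g y), (coc g y * c.2)%g)]).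
- case: F => F FP /= c c' c''.
  move=> [mu [g [nu [y [F1 ny e1 ->]]]]] [xi [h [eta [z [F2 ez e2 ->]]]]].
  have e : cmp nu y = cmp eta z by rewrite -e1 e2.
  have [? ? ?] := SGL_src_eq FP F1 F2 ny ez e; subst xi h eta.
  by rewrite (cmpI ny ez e).
- case: F => F FP /= [c1 c2] [d1 d2] c''.
  move=> [mu [g [nu [y [F1 ny /= -> ->]]]]] [xi [h [eta [z [F2 ez /= -> [e e']]]]]].
  have my := SGL_composable FP F1 ny; have mz := SGL_composable FP F2 ez.
  have [? ? ?] := SGL_tgt_eq FP F1 F2 my mz e; subst xi h eta.
  have := congr1 (act g^-1%g) (cmpI my mz e); rewrite !actK => ?; subst z.
  by move: e' => /mulgI ->.
Defined.

Lemma SGL_mul_core (E F : set triple) mu g nu xi h eta al be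
    mu' g' nu' xi' h' eta' al' be' a b :
  in_SGL E -> in_SGL F ->
  E (mu, g, nu) -> F (xi, h, eta) -> Lmin nu xi (al, be) ->
  E (mu', g', nu') -> F (xi', h', eta') -> Lmin nu' xi' (al', be') ->
  sc al = rg a -> sc al' = rg b ->
  cmp nu (cmp al a) = cmp nu' (cmp al' b) ->
  [/\ (mu, g, nu) = (mu', g', nu'), (xi, h, eta) = (xi', h', eta')
    & (al, be) = (al', be')].
Proof.
move=> EP FP E1 F1 [/= na xb e1 d1] E2 F2 [/= na' xb' e2 d2] aa ab e.
have ba : sc be = rg a by rewrite -aa -(sc_cmp na) e1 sc_cmp.
have bb : sc be' = rg b by rewrite -ab -(sc_cmp na') e2 sc_cmp.
have e' : cmp xi (cmp be a) = cmp xi' (cmp be' b).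
  by rewrite cmpA // -e1 -cmpA // e cmpA // e2 -cmpA.
have EE := SGL_src_eq EP E1 E2 (rg_cmpE na aa) (rg_cmpE na' ab) e.
have FF := SGL_tgt_eq FP F1 F2 (rg_cmpE xb ba) (rg_cmpE xb' bb) e'.
case: (EE) => ? ? ?; case: (FF) => ? ? ?; subst mu' g' nu' xi' h' eta'.
split=> //.
have ea : cmp (cmp nu al) a = cmp (cmp nu al') b by rewrite -!cmpA.
have ca : sc (cmp nu al) = rg a by rewrite sc_cmp.
have cb : sc (cmp nu al') = rg b by rewrite sc_cmp.
have [en _] := factor_uniq ca cb ea (etrans d1 (esym d2)).
rewrite (cmpI na na' en); congr pair.
by apply: (cmpI xb xb'); rewrite -e1 en.
Qed.

Lemma in_SGL_mul (E F : SGL_elt) : in_SGL (SGL_mul (SGL_val E) (SGL_val F)).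
Proof.
case: E F => [E EP] [F FP] /=; split.
- have [Ef _ _] := EP; have [Ff _ _] := FP.
  pose f (p : triple * triple) (q : L * L) : triple :=
    (cmp p.1.1.1 (act p.1.1.2 q.1),
     (coc p.1.1.2 q.1 * coc p.2.1.2 (act p.2.1.2^-1%g q.2))%g,
     cmp p.2.2 (act p.2.1.2^-1%g q.2)).
  apply: (@sub_finite_set _ _
    (\bigcup_(p in E `*` F) f p @` Lmin p.1.2 p.2.1.1)).
    move=> t [mu [g [nu [xi [h [eta [al [be [E1 F1 ab ->]]]]]]]]].
    by exists ((mu, g, nu), (xi, h, eta)) => //; exists (al, be).
  apply: bigcup_finite; first exact: finite_setX.
  by move=> p _; apply: finite_image; exact: ss_finitely_aligned A _ _.
- move=> x l z [mu [g [nu [xi [h [eta [al [be [E1 F1 [/= na xb e d]]]]]]]]]].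
  move=> [-> -> ->]; rewrite !sc_cmp; last 2 first.
    exact: SGL_composableV FP F1 xb.
    exact: SGL_composable EP E1 na.
  rewrite actM -sc_act_coc -!sc_act actKV !sc_act -(sc_cmp xb) -e sc_cmp //.
  exact: sc_act_coc.
- move=> ? ? ? ? ? ?.
  move=> [mu [g [nu [xi [h [eta [al [be [E1 F1 ab [-> -> ->]]]]]]]]]].
  move=> [mu' [g' [nu' [xi' [h' [eta' [al' [be' [E2 F2 ab' [-> -> ->]]]]]]]]]].
  move=> ne; have [/= na xb e d] := ab; have [/= na' xb' e' d'] := ab'.
  have main a b : sc al = rg a -> sc al' = rg b ->
      cmp nu (cmp al a) <> cmp nu' (cmp al' b).
    move=> aa bb ee.
    have [[? ? ?] [? ? ?] [? ?]] :=
      SGL_mul_core EP FP E1 F1 ab E2 F2 ab' aa bb ee.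
    by subst mu' g' nu' xi' h' eta' al' be'; exact: ne.
  have sab : sc al = sc be by rewrite -(sc_cmp na) e sc_cmp.
  have sab' : sc al' = sc be' by rewrite -(sc_cmp na') e' sc_cmp.
  have c1 := SGL_composable EP E1 na; have c2 := SGL_composable EP E2 na'.
  have c3 := SGL_composableV FP F1 xb; have c4 := SGL_composableV FP F2 xb'.
  split; apply/seteqP; split=> // -[a b] [/=].
  + rewrite !sc_cmp // => ma mb ee _; rewrite -!cmpA // in ee.
    have [? ? ?] := SGL_tgt_eq EP E1 E2 (rg_cmpE c1 ma) (rg_cmpE c2 mb) ee.
    subst mu' g' nu'.
    have := congr1 (act g^-1%g) (cmpI (rg_cmpE c1 ma) (rg_cmpE c2 mb) ee).
    have [x1 ->] := act_cmp A g^-1%g ma; have [x2 ->] := act_cmp A g^-1%g mb.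
    by rewrite !actK in x1 x2 * => /(congr1 (cmp nu)); exact: main.
  + rewrite !sc_cmp // => ma mb ee _; rewrite -!cmpA // in ee.
    have [? ? ?] := SGL_src_eq FP F1 F2 (rg_cmpE c3 ma) (rg_cmpE c4 mb) ee.
    subst xi' h' eta'.
    have := congr1 (act h) (cmpI (rg_cmpE c3 ma) (rg_cmpE c4 mb) ee).
    have [x1 ->] := act_cmp A h ma; have [x2 ->] := act_cmp A h mb.
    rewrite !actKV in x1 x2 * => /(congr1 (cmp xi)).
    rewrite !cmpA // -e -e' -!cmpA ?sab ?sab' //.
    by apply: main; rewrite ?sab ?sab'.
Qed.

Lemma in_SGL_star (F : SGL_elt) : in_SGL (SGL_star (SGL_val F)).
Proof.
case: F => [F FP] /=; have [Ff Fs Fd] := FP; split.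
- apply: (@sub_finite_set _ _
    ((fun t : triple => (t.2, t.1.2^-1%g, t.1.1)) @` F)).
    by move=> t [mu [g [nu [F1 ->]]]]; exists (mu, g, nu).
  exact: finite_image.
- by move=> ? ? ? [mu [g [nu [F1 [-> -> ->]]]]]; rewrite (Fs _ _ _ F1) actK.
- move=> ? ? ? ? ? ? [mu [g [nu [F1 [-> -> ->]]]]].
  move=> [mu' [g' [nu' [F2 [-> -> ->]]]]] ne.
  have [] := Fd _ _ _ _ _ _ F1 F2; last by [].
  by move=> [? ? ?]; subst; exact: ne.
Qed.

Lemma in_SGL_zero : in_SGL (set0 : set triple).
Proof. by split. Qed.

Lemma SGL_rho_inj (E F : SGL_elt) : SGL_rho E = SGL_rho F -> E = F.
Proof.
suff sub E' F' : SGL_rho E' = SGL_rho F' -> SGL_val E' `<=` SGL_val F'.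
  by move=> e; apply: SGL_val_inj; apply/seteqP; split; exact: sub.
move=> e [[mu g] nu] E1.
have rr X m i n : SGL_val X (m, i, n) -> SGL_rho X (n, 1%g) (m, i).
  move=> X1; have [_ /(_ _ _ _ X1) s _] := SGL_valP X.
  exists m, i, n, (sc n); split; rewrite ?rg_sc ?cmp_sc //.
  by rewrite -s cmp_sc coc_obj ?mulg1 // /is_object rg_sc.
have := rr _ _ _ _ E1.
rewrite e => -[mu' [g' [nu' [y [F1 ny /= en [em eg]]]]]].
have := rr _ _ _ _ F1.
rewrite -e => -[mu2 [g2 [nu2 [y2 [E2 ny2 /= en2 _]]]]].
have cy : sc y2 = rg y by rewrite -ny en2 sc_cmp.
have nn : sc nu = rg (sc nu) by rewrite rg_sc.
have en3 : cmp nu (sc nu) = cmp nu2 (cmp y2 y).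
  by rewrite cmp_sc cmpA // -en2 -en.
have [_ _ ?] := SGL_src_eq (SGL_valP E') E1 E2 nn (rg_cmpE ny2 cy) en3.
subst nu2.
have /deg0_sc[_ yr] : deg y = dg0.
  apply/funext => i; apply/eqP; rewrite -leqn0 /dg0.
  have := congr1 (fun l => deg l i) en; rewrite /= deg_cmp // en2 deg_cmp //.
  rewrite /dgD -addnA => /eqP.
  by rewrite -{1}[deg nu i]addn0 eqn_add2l eq_sym addn_eq0 => /andP[_ /eqP ->].
have ys : y = sc nu' by rewrite ny.
have [_ /(_ _ _ _ F1) s _] := SGL_valP F'.
rewrite en em eg ys cmp_sc -s cmp_sc coc_obj ?mulg1 //.
by rewrite /is_object rg_sc.
Qed.

Definition SGL_zero : SGL_elt := SGLElt in_SGL_zero.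
Definition SGL_mul_elt (E F : SGL_elt) : SGL_elt := SGLElt (in_SGL_mul E F).
Definition SGL_star_elt (F : SGL_elt) : SGL_elt := SGLElt (in_SGL_star F).

Lemma SGL_rho0 : SGL_rho SGL_zero = pbempty _.
Proof. by apply: pbijP => c c'; split=> // -[mu [g [nu [y []]]]]. Qed.

Lemma SGL_rhoV (F : SGL_elt) : SGL_rho (SGL_star_elt F) = pbinv (SGL_rho F).
Proof.
have FP := SGL_valP F.
apply: pbijP => -[c1 c2] [d1 d2]; split => /=.
- move=> [? [? [? [y [[mu [g [nu [F1 [-> -> ->]]]]] my /= e1 [-> ->]]]]]].
  exists mu, g, nu, (act g^-1%g y); split=> //.
    exact: SGL_composableV FP F1 my.
  by rewrite actKV e1 mulgA -cocM mulgV coc1 mul1g.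
- move=> [mu [g [nu [y [F1 ny /= e1 [-> ->]]]]]].
  exists nu, g^-1%g, mu, (act g y); split=> //.
  + by exists mu, g, nu.
  + exact: SGL_composable FP F1 ny.
  + by rewrite actK e1 mulgA -cocM mulVg coc1 mul1g.
Qed.

Lemma SGL_rhoM (E F : SGL_elt) :
  SGL_rho (SGL_mul_elt E F) = pbcomp (SGL_rho E) (SGL_rho F).
Proof.
have EP := SGL_valP E; have FP := SGL_valP F.
apply: pbijP => -[c1 c2] [d1 d2]; split => /=.
- move=> [? [? [? [z [t P1 P2 P3]]]]]; move: t P1 P2 P3.
  move=> [mu [g [nu [xi [h [eta [al [be [E1 F1 ab [-> -> ->]]]]]]]]]].
  have [/= na xb e d] := ab; have cb := SGL_composableV FP F1 xb.
  have ca := SGL_composable EP E1 na.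
  rewrite sc_cmp // => bz /= -> [-> ->].
  set be' := act h^-1%g be in cb bz *.
  have [x1 x2] := act_cmp A h bz; rewrite actKV in x1 x2.
  have aw : sc al = rg (act (coc h be') z).
    by rewrite -x1 -(sc_cmp na) e sc_cmp.
  exists (cmp xi (act h (cmp be' z)), (coc h (cmp be' z) * c2)%g).
    exists xi, h, eta, (cmp be' z); split=> //.
    + exact: rg_cmpE.
    + by rewrite /= cmpA.
  exists mu, g, nu, (cmp al (act (coc h be') z)); split=> //.
  + exact: rg_cmpE.
  + by rewrite /= x2 !cmpA // e.
  + have [y1 ->] := act_cmp A g aw.
    by rewrite cmpA // -actM !coc_cmp // cocM mulgA.
- move=> [[m1 m2]] [xi [h [eta [y [F1 ey /= -> [m1E m2E]]]]]].
  move=> [mu [g [nu [u [E1 nu_u /= m1E' [-> ->]]]]]].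
  have xy := SGL_composable FP F1 ey.
  have ee : cmp nu u = cmp xi (act h y) by rewrite -m1E -m1E'.
  have [[al be] [w [ab /= aw bw ue ye]]] := common_ext nu_u xy ee.
  have [/= na xb e d] := ab.
  have cb := SGL_composableV FP F1 xb; have ca := SGL_composable EP E1 na.
  have [x1 x2] := act_cmp A h^-1%g bw; rewrite -ye actK in x2.
  set z := act _ w in x1 x2; set be' := act _ be in x1 x2 cb.
  have zw : act (coc h be') z = w.
    by rewrite -actM -cocM mulgV coc1 act1.
  exists (cmp mu (act g al)), (coc g al * coc h be')%g, (cmp eta be'), z.
  split.
  + by exists mu, g, nu, xi, h, eta, al, be.
  + by rewrite sc_cmp.
  + by rewrite x2 cmpA.
  + have [y1 y2] := act_cmp A g aw.
    rewrite /= m2E ue y2 actM zw cocM zw (coc_cmp A _ aw) x2 coc_cmp //.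
    by rewrite cmpA // mulgA.
Qed.

Definition SGL : invSemigroup0 :=
  @embeddedInvSemigroup0 (L * G)%type SGL_elt SGL_mul_elt SGL_star_elt SGL_zero
    SGL_rho SGL_rho_inj SGL_rhoM SGL_rhoV SGL_rho0.

Lemma in_SGL_single mu g nu : sc mu = act g (sc nu) ->
  in_SGL [set (mu, g, nu)].
Proof.
move=> e; split; first exact: finite_set1.
- by move=> ? ? ? [-> -> ->].
- by move=> ? ? ? ? ? ? -> ->.
Qed.

Definition SGL_single mu g nu (e : sc mu = act g (sc nu)) : SGL :=
  SGLElt (in_SGL_single e).

Definition SGL_filter (x : prepath L) : set SGL :=
  [set E : SGL | idem E /\ exists2 n, edgle n (pdeg x) &
     SGL_val E (pmor x dg0 n, 1%g, pmor x dg0 n)].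

Definition zs_filter (x : prepath L) : set (SC zappaSzep) :=
  [set f : SC zappaSzep | idem f /\ exists2 n, edgle n (pdeg x) &
     exists c, SC_val f (pmor x dg0 n, 1%g) c].

End SelfSimilar.

Arguments SGL_filter {k L G} A x.
Arguments zs_filter {k L G} A x.

(* Main.v *)
(* SC(C), for C the Zappa-Szep product, is an inverse subsemigroup of S_{G,Lambda}:
   both are represented faithfully by partial bijections of C, in which the
   triple (mu, g, nu) acts as tau^(mu,g) sigma^(nu,e), every tau^a is a triple, and
   S_{G,Lambda} is closed under products and inverses.  Moreover each element of
   S_{G,Lambda} is a finite union of triples, and triples lie in SC(C).  A tight
   filter that contains an idempotent meets each of its finite covers, so tight
   filters and germs are determined by their restrictions to such a subsemigroup,
   and restriction is an isomorphism of tight groupoids.  It remains to identify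
   tight filters of S_{G,Lambda} with boundary paths: a filter is tight exactly
   when it satisfies the cover condition, which for the set of those mu with
   {(mu, e, mu)} in the filter is the condition on FE sets. *)
Require Import Defs.
From mathcomp Require Import all_boot finmap.
From mathcomp Require Import boolp classical_sets functions cardinality.
From mathcomp Require Import topology.

Set Implicit Arguments.
Unset Strict Implicit.
Unset Printing Implicit Defensive.

Local Open Scope classical_set_scope.

(** * Tight filters and germs of an inverse semigroup *)

(** Ultrafilters of the two semigroups are not compared directly, so closure of the ultrafilters is
    a poor form of tightness to carry along an inclusion. The cover condition, packaged as
    [tight_set], speaks only of idempotents and finite sets; it transfers once every idempotent of
    the large semigroup has a finite cover from the small one. Beyond being an injective
    homomorphism, the inclusion [j] is asked only to satisfy [j_dense]. The groupoid operations are
    relations asking for suitable representatives, so the work on germs is to change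
    representatives; the isomorphism is first a relation between germs and becomes a function by
    choice. Boundary paths carry degrees and junk values, whereas filters see only which elements of
    Lambda are initial segments. [boundary_set] mediates, and [boundary_path_set], [path_set_concat]
    and [boundary_set_path] translate between the two. The group disappears from idempotents, all of
    whose triples have the form (nu, e, nu). *)

Section InverseSemigroup.
Variable S : invSemigroup0.
Local Notation "a * b" := (ismul a b).
Local Notation "a ^*" := (isstar a).
Implicit Types (a b e f s t : S) (c d : tightGroupoid S).

Lemma idem_starl a : idem (a^* * a).
Proof. by rewrite /idem /= ismulA isstar_mul. Qed.

Lemma idem_starr a : idem (a * a^*).
Proof. by rewrite /idem /= ismulA ismul_star. Qed.

(** Commuting idempotents force both [b] and [a^*] to equal [a^* * (a * b)]. *)
Lemma isstar_uniq a b : a * b * a = a -> b * a * b = b -> b = a^*.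
Proof.
move=> aba bab.
have iab : idem (a * b) by rewrite /idem /= ismulA aba.
have iba : idem (b * a) by rewrite /idem /= ismulA bab.
have e1 : b = a^* * (a * b).
  transitivity (b * a * (a^* * a) * b).
    by rewrite -(ismulA b) (ismulA a) ismul_star bab.
  by rewrite (isidemC iba (idem_starl a)) -!ismulA (ismulA b) bab.
have e2 : a^* = a^* * (a * b).
  transitivity (a^* * (a * b * (a * a^*))).
    by rewrite !ismulA -(ismulA a^*) -(ismulA a^*) aba isstar_mul.
  by rewrite (isidemC iab (idem_starr a)) !ismulA isstar_mul.
by rewrite e1 -e2.
Qed.

Lemma isstarM a b : (a * b)^* = b^* * a^*.
Proof.
have C := isidemC (idem_starr b) (idem_starl a).
apply/esym/isstar_uniq.
- rewrite -!ismulA (ismulA b) (ismulA a^*) (ismulA (b * b^*)) C.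
  by rewrite -!ismulA (ismulA b) ismul_star !ismulA ismul_star.
- rewrite -!ismulA (ismulA a^*) (ismulA b) (ismulA (a^* * a)) -C.
  by rewrite -!ismulA (ismulA a^*) isstar_mul !ismulA isstar_mul.
Qed.

Lemma isstar_idem e : idem e -> e^* = e.
Proof. by rewrite /idem /= => ee; apply/esym/isstar_uniq; rewrite !ee. Qed.

Lemma idemM e f : idem e -> idem f -> idem (e * f).
Proof.
move=> ie jf; rewrite /idem /= -ismulA (ismulA f) (isidemC jf ie).
by rewrite -ismulA jf ismulA ie.
Qed.

Lemma idem_mul_conj s e : idem e -> s * e * s^* * s = s * e.
Proof.
move=> ie; rewrite -!ismulA (isidemC ie (idem_starl s)) !ismulA.
by rewrite ismul_star.
Qed.

Lemma idem_conj s e : idem e -> idem (s * e * s^*).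
Proof.
by move=> ie; rewrite /idem /= !ismulA idem_mul_conj // -(ismulA s e e) ie.
Qed.

Lemma idem_le_trans e f g : idem_le e f -> idem_le f g -> idem_le e g.
Proof. by rewrite /idem_le => ef fg; rewrite -ef -ismulA fg. Qed.

Lemma idem_leMl e f : idem e -> idem f -> idem_le (e * f) e.
Proof.
by move=> ie jf; rewrite /idem_le -ismulA (isidemC jf ie) ismulA ie.
Qed.

Lemma idem_leMr e f : idem f -> idem_le (e * f) f.
Proof. by move=> jf; rewrite /idem_le -ismulA jf. Qed.

Lemma idem_le_conj s e f : idem e -> idem f -> idem_le e f ->
  idem_le (s * e * s^*) (s * f * s^*).
Proof.
move=> ie jf ef; rewrite /idem_le !ismulA idem_mul_conj //.
by rewrite -(ismulA s) ef.
Qed.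

(* Unlike in Exel's definition, the elements of X need not lie below e. *)
Definition covers (X : set S) (e : S) : Prop :=
  forall f, idem f -> idem_le f e -> (forall x, X x -> f * x = iszero S) ->
    f = iszero S.

(** The intrinsic form of tightness, shown equivalent to the topological one in [is_tightP]. It
    concerns a plain set because germs carry plain sets. *)
Record tight_set (F : set S) : Prop := {
  ts_idem : F `<=` @idem S;
  ts_neq0 : F !=set0;
  ts_mul : forall e f, F e -> F f -> F (e * f);
  ts_up : forall e f, F e -> idem f -> idem_le e f -> F f;
  ts_zero : ~ F (iszero S);
  ts_cover : forall e X, F e -> finite_set X -> X `<=` @idem S ->
    covers X e -> exists2 x, X x & F x
}.

Lemma filter0_ext (F F' : filter0 S) : filter_set F = filter_set F' -> F = F'.
Proof.
case: F => F ? ? ? ? ?; case: F' => F' ? ? ? ? ? /= e; subst F'.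
by congr Filter0; exact: Prop_irrelevance.
Qed.

Lemma open_filter0E : @open (filter0 S) =
  [set \bigcup_(B in D) B | D in subset^~ (finI_from (@filter0_subbase S) id)].
Proof. by []. Qed.

Lemma open_filter0_subbase (B : set (filter0 S)) :
  filter0_subbase B -> open B.
Proof.
move=> sB; rewrite open_filter0E; exists [set B]; last by rewrite bigcup_set1.
move=> _ ->; exists [fset B]%fset.
  by move=> C /fset1P ->; exact/mem_set.
by rewrite set_fset1 bigcap_set1.
Qed.

(* Filters are closed under products, so finite intersections of subbasic sets
   through F reduce to a single one. *)
Lemma open_filter0_basis (V : set (filter0 S)) (F : filter0 S) :
  open V -> V F ->
  exists e X, [/\ filter_set F e, finite_set X, X `<=` @idem S,
    forall x, X x -> ~ filter_set F x
    & forall H : filter0 S, filter_set H e ->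
        (forall x, X x -> ~ filter_set H x) -> V H].
Proof.
rewrite open_filter0E => -[D' D'b <-] [B DB BF].
have [D sD EB] := D'b _ DB.
suff [e [X [Fe fX iX FX sub]]] : exists e X, [/\ filter_set F e, finite_set X,
    X `<=` @idem S, forall x, X x -> ~ filter_set F x
    & forall H : filter0 S, filter_set H e ->
        (forall x, X x -> ~ filter_set H x) ->
        forall C, C \in (enum_fset D) -> C H].
  exists e, X; split=> // H He HX; exists B => //.
  by rewrite -EB => C CD; exact: sub.
have {D'b DB} FD C : C \in (enum_fset D) -> filter0_subbase C /\ C F.
  by move=> CD; split; [exact/set_mem/sD|move: BF; rewrite -EB; exact].
elim: (enum_fset D) FD => [_|C s IH FD].
  have [e Fe] := filter_neq0 F.
  by exists e, set0; split=> //; exact: finite_set0.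
have [|e [X [Fe fX iX FX sub]]] := IH.
  by move=> C' C's; apply: FD; rewrite inE C's orbT.
have [[e' [X' [ie' fX' iX' EC]]] CF] := FD C (mem_head _ _).
move: CF; rewrite EC => -[Fe' FX'].
exists (e * e'), (X `|` X'); split.
- exact: filter_mul.
- by rewrite finite_setU.
- by move=> x [/iX|/iX'].
- by move=> x [/FX|/FX'].
- move=> H He HX; have ie := filter_idem Fe.
  have He1 : filter_set H e by apply: filter_up He ie (idem_leMl ie ie').
  have He2 : filter_set H e' by apply: filter_up He ie' (idem_leMr _ ie').
  move=> C'; rewrite inE => /orP[/eqP ->|]; last first.
    by apply: sub => // x Xx; apply: HX; left.
  by split=> // x Xx; apply: HX; right.
Qed.

(** Zorn's lemma on the filters above [F]. A nonempty chain is bounded by its union; the empty chain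
    needs [F] itself, since an empty union is not a filter. *)
Lemma ultrafilter_extension (F : filter0 S) :
  exists2 U, ultrafilters U & filter_set F `<=` filter_set U.
Proof.
pose T := {U : filter0 S | filter_set F `<=` filter_set U}.
pose R (U V : T) := `[< filter_set (sval U) `<=` filter_set (sval V) >].
pose F0 : T := exist _ F (@subset_refl _ _).
have [||A Atot|[U FU] Umax] := @ZL_preorder T F0 R.
- by move=> U; apply/asboolP.
- move=> V U W /asboolP UV /asboolP VW; apply/asboolP.
  exact: subset_trans UV VW.
- have [[U0 AU0]|A0] := pselect (A !=set0); last first.
    by exists F0 => U AU; exfalso; apply: A0; exists U.
  pose P : set S := [set e | exists2 U, A U & filter_set (sval U) e].
  have FP : filter_set F `<=` P.
    by move=> e Fe; exists U0 => //; exact: (svalP U0).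
  have Pm e f : P e -> P f -> P (e * f).
    move=> [U AU Ue] [V AV Vf].
    have [/asboolP UV|/asboolP VU] := Atot _ _ AU AV.
      by exists V => //; apply: filter_mul => //; exact: UV.
    by exists U => //; apply: filter_mul => //; exact: VU.
  have Pi : P `<=` @idem S by move=> e [U _ /filter_idem].
  have Pn : P !=set0 by have [e Fe] := filter_neq0 F; exists e; exact: FP.
  have Pu e f : P e -> idem f -> idem_le e f -> P f.
    by move=> [U AU Ue] jf ef; exists U => //; exact: filter_up Ue jf ef.
  have P0 : ~ P (iszero S) by move=> [U _ /filter_zero].
  exists (exist _ (Filter0 Pi Pn Pm Pu P0) FP) => U AU.
  by apply/asboolP => e Ue; exists U.
exists U => // V UV.
apply: filter0_ext; apply/seteqP; split=> //.
have FV : filter_set F `<=` filter_set V by exact: subset_trans FU UV.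
by apply/asboolP/(Umax (exist _ V FV))/asboolP.
Qed.

Lemma up_filter0 e : idem e -> e <> iszero S ->
  exists F : filter0 S, filter_set F = [set f | idem f /\ idem_le e f].
Proof.
move=> ie e0.
unshelve eexists (@Filter0 S [set f | idem f /\ idem_le e f] _ _ _ _ _) => //.
- by move=> f [].
- by exists e.
- move=> f g [jf ef] [ig eg]; split; first exact: idemM.
  by rewrite /idem_le ismulA ef eg.
- by move=> f g [jf ef] ig fg; split=> //; exact: idem_le_trans ef fg.
- by move=> [_]; rewrite /idem_le ismuls0 => /esym.
Qed.

(** If no member of [U] were orthogonal to [x], then [U] and [x] would generate a filter [P] without
    zero, and maximality would put [x] in [U]. *)
Lemma ultrafilter_sep (U : filter0 S) x : ultrafilters U -> idem x ->
  ~ filter_set U x -> exists2 f, filter_set U f & f * x = iszero S.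
Proof.
move=> Umax ix Ux; apply: contrapT => nf.
have nz f : filter_set U f -> f * x <> iszero S by move=> Uf fx; apply: nf; exists f.
pose P : set S := [set g | idem g /\ exists2 f, filter_set U f & idem_le (f * x) g].
have Pm e f : P e -> P f -> P (e * f).
  move=> [ie [e' Ue' ee]] [jf [f' Uf' ff]]; split; first exact: idemM.
  exists (e' * f'); first exact: filter_mul.
  have C := isidemC (filter_idem Ue') (filter_idem Uf').
  rewrite /idem_le ismulA C -(ismulA f') -(ismulA f') ee ismulA -C.
  by rewrite -!ismulA (ismulA f') ff.
have Pi : P `<=` @idem S by move=> e [].
have xle f : idem f -> idem_le (f * x) x by move=> jf; exact: idem_leMr.
have [f0 Uf0] := filter_neq0 U.
have Px : P x by split=> //; exists f0 => //; exact: xle (filter_idem Uf0).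
have UP : filter_set U `<=` P.
  move=> f Uf; have jf := filter_idem Uf; split=> //; exists f => //.
  exact: idem_leMl.
have Pn : P !=set0 by exists x.
have Pu e f : P e -> idem f -> idem_le e f -> P f.
  move=> [ie [e' Ue' ee]] jf ef; split=> //; exists e' => //.
  exact: idem_le_trans ee ef.
have P0 : ~ P (iszero S).
  by move=> [_ [f Uf]]; rewrite /idem_le ismuls0 => /esym; exact: nz.
by apply: Ux; rewrite (Umax (Filter0 Pi Pn Pm Pu P0) UP).
Qed.

(** If [U] missed [X], the product of [e] with one separating element for each member of [X] would
    lie in [U], below [e] and orthogonal to [X], hence be zero. *)
Lemma ultrafilter_cover (U : filter0 S) e X : ultrafilters U ->
  filter_set U e -> finite_set X -> X `<=` @idem S -> covers X e ->
  exists2 x, X x & filter_set U x.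
Proof.
move=> Umax Ue /(@finite_seqP {classic S})[s Xs] iX cX; apply: contrapT => nX.
have [f [Uf fe fX]] : exists f, [/\ filter_set U f, idem_le f e
    & forall x, x \in s -> f * x = iszero S].
  have : forall x, x \in s -> idem x /\ ~ filter_set U x.
    move=> x xs; have Xx : X x by rewrite Xs.
    by split; [exact: iX|move=> Ux; apply: nX; exists x].
  elim: (s) => [_|x r IH H]; first by exists e; split=> //; exact: (filter_idem Ue).
  have [|f [Uf fe fr]] := IH; first by move=> y yr; apply: H; rewrite inE yr orbT.
  have [ix Ux] := H x (mem_head _ _).
  have [g Ug gx] := ultrafilter_sep Umax ix Ux.
  have C := isidemC (filter_idem Uf) (filter_idem Ug).
  exists (f * g); split; first exact: filter_mul.
    by rewrite /idem_le C -ismulA fe.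
  move=> y; rewrite inE => /orP[/eqP ->|/fr fy]; first by rewrite -ismulA gx ismuls0.
  by rewrite C -ismulA fy ismuls0.
have f0 : f = iszero S.
  by apply: cX => //; [exact: filter_idem Uf|move=> x; rewrite Xs; exact: fX].
by apply: (@filter_zero _ U); rewrite -f0.
Qed.

(** If [F] contained [e] and missed a cover [X], these two conditions would define an open set
    around [F] without ultrafilters. Conversely, given a basic neighbourhood (e, X) of [F], the set
    [X] does not cover [e]; an ultrafilter through a nonzero [f] below [e] and orthogonal to [X]
    lies in that neighbourhood. *)
Lemma is_tightP (F : set S) : is_tight F <-> tight_set F.
Proof.
split=> [[F' F't ->]|[iF nF mF uF zF cF]].
  split; [exact: filter_idem|exact: filter_neq0|exact: filter_mul
    |exact: filter_up|exact: filter_zero|].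
  move=> e X Fe fX iX cX; apply: contrapT => nX.
  pose B := [set H : filter0 S | filter_set H e /\
                               forall f, X f -> ~ filter_set H f].
  have oB : open B.
    by apply: open_filter0_subbase; exists e, X; split=> //; exact: (filter_idem Fe).
  have [|U [Umax [Ue UX]]] := F't B.
    apply: open_nbhs_nbhs; split=> //; split=> // x Xx Fx.
    by apply: nX; exists x.
  have [x Xx Ux] := ultrafilter_cover Umax Ue fX iX cX.
  exact: UX Xx Ux.
exists (Filter0 iF nF mF uF zF) => //.
move=> V; rewrite nbhsE => -[W [oW WF] WV].
have [e [X [Fe fX iX FX sub]]] := open_filter0_basis oW WF.
have ie := iF _ Fe.
have [f [jf fe fX0 f0]] : exists f, [/\ idem f, idem_le f e,
    forall x, X x -> f * x = iszero S & f <> iszero S].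
  apply: contrapT => nf.
  have [|x Xx Fx] := cF _ _ Fe fX iX; last exact: FX Xx Fx.
  by move=> f jf fe fX0; apply: contrapT => f0; apply: nf; exists f.
have [H EH] := up_filter0 jf f0; have [U Umax HU] := ultrafilter_extension H.
have Uf : filter_set U f by apply: HU; rewrite EH.
exists U; split=> //; apply/WV/sub; first exact: filter_up Uf ie fe.
move=> x Xx Ux; apply: (@filter_zero _ U); rewrite -(fX0 _ Xx).
exact: filter_mul.
Qed.

(** * Germs and change of representative *)

Lemma germ_class_eq s t F : tight_set F -> F (s^* * s) -> F (t^* * t) ->
  (germ_class s F = germ_class t F <-> exists2 e, F e & s * e = t * e).
Proof.
move=> tF Fs Ft; split=> [E|[e Fe se]].
  have : germ_class s F (t, F).
    by rewrite E; split=> //=; exists (t^* * t).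
  by move=> [_ _ [e Fe se]]; exists e.
have C f g : F f -> F g -> f * g = g * f.
  by move=> /(ts_idem tF) jf /(ts_idem tF) jg; exact: isidemC.
apply/seteqP; split=> -[u F'] [/= -> Fu [f Ff sf]]; split=> //=;
  exists (e * f); do ?exact: (ts_mul tF).
- by rewrite ismulA -se -ismulA (C e f) // ismulA sf -ismulA.
- by rewrite ismulA se -ismulA (C e f) // ismulA sf -ismulA.
Qed.

Lemma tightGroupoid_ext (c d : tightGroupoid S) :
  germ_val c = germ_val d -> c = d.
Proof.
case: c d => [c cP] [d dP] /= e; subst d.
by congr TightGroupoid; exact: Prop_irrelevance.
Qed.

Lemma is_germ_inj c d s F : is_germ c s F -> is_germ d s F -> c = d.
Proof. by move=> [_ _ cE] [_ _ dE]; apply: tightGroupoid_ext; rewrite cE dE. Qed.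

Lemma is_germ_ex s F : is_tight F -> F (s^* * s) -> exists c, is_germ c s F.
Proof.
move=> tF Fs.
by exists (TightGroupoid (ex_intro _ s (ex_intro _ F (And3 tF Fs erefl)))).
Qed.

Lemma is_germ_dom c s t F F' : is_germ c s F -> is_germ c t F' -> F = F'.
Proof.
move=> [_ Fs cE] [_ _ cE'].
have /= : germ_class t F' (s, F).
  by rewrite -cE' cE; split=> //=; exists (s^* * s).
by move=> [].
Qed.

Lemma is_germ_eq c s t F : is_germ c s F -> is_germ c t F ->
  exists2 e, F e & s * e = t * e.
Proof.
move=> [/is_tightP tF Fs cE] [_ Ft cE'].
by apply/(germ_class_eq tF Fs Ft); rewrite -cE.
Qed.

(** This carries the domain condition of a germ over to any element that agrees with its
    representative on a member of the filter. *)
Lemma star_idem_le s t e : idem e -> s * e = t * e ->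
  idem_le (t^* * t * e) (s^* * s).
Proof.
move=> ie se; rewrite /idem_le -(ismulA t^*) -se -!ismulA.
rewrite (isidemC ie (idem_starl s)) !ismulA -(ismulA t^*) -(ismulA t^*).
by rewrite ismul_star.
Qed.

Lemma star_agree s t e : idem e -> s * e = t * e -> e * s^* = e * t^*.
Proof.
by move=> ie se; rewrite -{1 2}(isstar_idem ie) -!isstarM se.
Qed.

Lemma is_germ_rep c s t F e : is_germ c s F -> F e -> s * e = t * e ->
  is_germ c t F.
Proof.
move=> [tF Fs cE] Fe se; have /is_tightP tF' := tF.
have ie := ts_idem tF' Fe.
have Ft : F (t^* * t).
  apply: (ts_up tF') (idem_starl t) (star_idem_le ie (esym se)).
  exact: (ts_mul tF').
by split=> //; rewrite cE; apply/germ_class_eq => //; exists e.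
Qed.

(** Every witness [g] in [F] may be shrunk to [e * g], on which both elements conjugate alike. *)
Lemma theta_rep s t F e : tight_set F -> F e -> s * e = t * e ->
  theta s F = theta t F.
Proof.
move=> tF; suff sub s' t' : F e -> s' * e = t' * e -> theta s' F `<=` theta t' F.
  by move=> Fe se; apply/seteqP; split; apply: sub.
move=> Fe se f [jf [g Fg gf]]; split=> //; exists (e * g); first exact: (ts_mul tF).
have ie := ts_idem tF Fe; have ig := ts_idem tF Fg.
suff -> : t' * (e * g) * t'^* = s' * (e * g) * s'^*.
  apply: idem_le_trans _ gf; apply: idem_le_conj => //; first exact: idemM.
  exact: idem_leMr.
have E : e * s'^* = e * t'^* := star_agree ie se.
have -> : e * g = e * g * e by rewrite -ismulA (isidemC ig ie) ismulA ie.
by rewrite !ismulA -se -!ismulA -E.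
Qed.

(** [germ_mul] provides some representatives only; this allows both factors to be replaced at once
    by representatives from the small semigroup. *)
Lemma germ_mul_rep c1 c2 c3 t s F t' s' e u :
  is_germ c1 t (theta s F) -> is_germ c2 s F -> is_germ c3 (t * s) F ->
  theta s F u -> t * u = t' * u -> F e -> s * e = s' * e ->
  [/\ is_germ c1 t' (theta s' F), is_germ c2 s' F & is_germ c3 (t' * s') F].
Proof.
move=> g1 g2 g3 Fu tu Fe se.
have [/is_tightP tF Fs _] := g2.
have g2' := is_germ_rep g2 Fe se.
split=> //; first by rewrite -(theta_rep tF Fe se); exact: is_germ_rep g1 Fu tu.
have [ju [f Ff fu]] := Fu.
have ie := ts_idem tF Fe; have jf := ts_idem tF Ff.
apply: (is_germ_rep g3 (ts_mul tF Ff Fe)).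
(* The idempotent [u] dominates the conjugate of [f] by [s], so it fixes [s * f] from the left; this
   lets [t] be exchanged for [t'] inside the product. *)
have E : s * f = u * (s * f).
  rewrite -(idem_mul_conj s jf) -{1}fu (isidemC (idem_conj s jf) ju).
  by rewrite -!ismulA.
rewrite ismulA -(ismulA t) E (ismulA t) tu -(ismulA t') -E.
rewrite -!ismulA (isidemC jf ie); congr (_ * _).
by rewrite !ismulA se.
Qed.

Lemma germ_inv_rep c c' s F s' e :
  is_germ c s F -> is_germ c' s^* (theta s F) -> F e -> s * e = s' * e ->
  is_germ c s' F /\ is_germ c' s'^* (theta s' F).
Proof.
move=> g1 g2 Fe se; have [/is_tightP tF Fs _] := g1.
split; first exact: is_germ_rep g1 Fe se.
rewrite -(theta_rep tF Fe se).
have ie := ts_idem tF Fe.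
(* The two stars agree on the conjugate of [e] by [s], which is the image of the idempotent where
   [s] and [s'] agree. *)
have K : theta s F (s * e * s^*).
  split; first exact: idem_conj.
  by exists e => //; exact: idem_conj.
apply: (is_germ_rep g2 K).
have E : e * s^* = e * s'^* := star_agree ie se.
have M x : x^* * (x * e * x^*) = e * x^*.
  rewrite !ismulA (isidemC (idem_starl x) ie) -!ismulA (ismulA x^*).
  by rewrite isstar_mul.
have N x : x * e * x^* = x * e * (e * x^*) by rewrite ismulA -(ismulA x e e) ie.
by rewrite M E -M (N s) E se -N.
Qed.

End InverseSemigroup.

(** * Continuity of maps into a groupoid of germs *)

Section GroupoidTopology.
Variable S : invSemigroup0.

Lemma open_tightGroupoidE : @open (tightGroupoid S) =
  [set \bigcup_(B in D) B |
     D in subset^~ (finI_from (@tightGroupoid_subbase S) id)].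
Proof. by []. Qed.

Lemma open_tightGroupoid_subbase (B : set (tightGroupoid S)) :
  tightGroupoid_subbase B -> open B.
Proof.
move=> sB; rewrite open_tightGroupoidE; exists [set B]; last by rewrite bigcup_set1.
move=> _ ->; exists [fset B]%fset.
  by move=> C /fset1P ->; exact/mem_set.
by rewrite set_fset1 bigcap_set1.
Qed.

Lemma tightGroupoid_continuous (X : topologicalType) (f : X -> tightGroupoid S) :
  (forall (s : S) (V : set (filter0 S)) (F : filter0 S) (x : X),
     open V -> V F -> is_germ (f x) s (filter_set F) ->
     \forall y \near x, exists2 H : filter0 S, V H & is_germ (f y) s (filter_set H)) ->
  continuous f.
Proof.
move=> Hf x W /=; rewrite nbhsE => -[U [oU Ux] UW].
move: oU; rewrite open_tightGroupoidE => -[D DB EU].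
have [B DB' Bx] : (\bigcup_(B in D) B) (f x) by rewrite EU.
have [Y sY EB] := DB _ DB'.
suff : nbhs x (\bigcap_(C in [set` Y]) (f @^-1` C)).
  apply: filterS => y Yy; apply: UW; rewrite -EU; exists B => //.
  by rewrite -EB => C YC; exact: Yy.
apply: filter_bigI => C CY.
have CY' : [set` Y] C by [].
have [s [V [oV EC]]] := set_mem (sY _ CY).
have : C (f x) by move: Bx; rewrite -EB; exact.
rewrite EC => -[F VF g]; exact: Hf g.
Qed.

End GroupoidTopology.

(** * Restriction to a dense inverse subsemigroup *)

Section DenseSubsemigroup.
Variables (S T : invSemigroup0) (j : T -> S).
Local Notation "a * b" := (ismul a b).
Local Notation "a ^*" := (isstar a).
Hypothesis j_inj : injective j.
Hypothesis jM : forall a b, j (a * b) = j a * j b.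
Hypothesis jV : forall a, j a^* = (j a)^*.
Hypothesis j0 : j (iszero T) = iszero S.
(** An abstract form of being a finite join of elements of [T]: each [j t] is the restriction of [s]
    to the domain of [t], and these domains cover that of [s]. *)
Hypothesis j_dense : forall s : S, exists X : set T, [/\ finite_set X,
  forall t, X t -> s * j (t^* * t) = j t
  & covers ((fun t => j (t^* * t)) @` X) (s^* * s)].

Lemma idem_j e : idem (j e) <-> idem e.
Proof. by rewrite /idem /= -jM; split=> [/j_inj|->]. Qed.

Lemma idem_le_j e f : idem_le (j e) (j f) <-> idem_le e f.
Proof. by rewrite /idem_le -jM; split=> [/j_inj|->]. Qed.

(** This is [j_dense] at an idempotent: restrictions of an idempotent are idempotent and hence equal
    to their own domains. *)
Lemma idem_cover (e : S) : idem e -> exists X : set T, [/\ finite_set X,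
  X `<=` @idem T, forall x, X x -> idem_le (j x) e & covers (j @` X) e].
Proof.
move=> ie; have [X [fX EX cX]] := j_dense e.
rewrite (isstar_idem ie) ie in cX.
have tt t : X t -> t^* * t = t.
  move=> Xt; have it : idem t.
    by apply/idem_j; rewrite -(EX _ Xt); apply: idemM => //; apply/idem_j/idem_starl.
  by rewrite isstar_idem.
exists X; split=> //.
- by move=> t Xt; rewrite -(tt _ Xt); exact: idem_starl.
- move=> t Xt; have it : idem (j t).
    by apply/idem_j; rewrite -(tt _ Xt); exact: idem_starl.
  by rewrite /idem_le (isidemC it ie) -{1}(tt _ Xt) EX.
- move=> f jf fe H; apply: cX => // _ [t Xt <-].
  by rewrite tt //; apply: H; exists t.
Qed.

Lemma idem_cover_choice : exists C : S -> set T, forall x, idem x ->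
  [/\ finite_set (C x), C x `<=` @idem T, forall y, C x y -> idem_le (j y) x
    & covers (j @` C x) x].
Proof.
suff /choice[C HC] : forall x : S, exists Y : set T, idem x -> [/\ finite_set Y,
    Y `<=` @idem T, forall y, Y y -> idem_le (j y) x & covers (j @` Y) x].
  by exists C.
move=> x; have [/idem_cover[Y HY]|nx] := pselect (idem x); first by exists Y.
by exists set0.
Qed.

Definition up_filter (F : set T) : set S :=
  [set e | idem e /\ exists2 e', F e' & idem_le (j e') e].

Lemma down_tight (F : set S) : tight_set F -> tight_set (j @^-1` F).
Proof.
move=> tF; split.
- by move=> e /(ts_idem tF) /idem_j.
- have [e Fe] := ts_neq0 tF; have [X [fX iX _ cX]] := idem_cover (ts_idem tF Fe).
  have [||_ [x Xx <-] Fx] := ts_cover tF Fe _ _ cX.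
  + exact: finite_image.
  + by move=> _ [x /iX ix <-]; apply/idem_j.
  + by exists x.
- by move=> e f /= Fe Ff; rewrite jM; exact: (ts_mul tF).
- by move=> e f /= Fe jf ef; apply: (ts_up tF Fe); [exact/idem_j|exact/idem_le_j].
- by rewrite /= j0; exact: (ts_zero tF).
- move=> e X /= Fe fX iX cX.
  have [|||_ [x Xx <-] Fx] := ts_cover tF Fe (X := j @` X); last by exists x.
  + exact: finite_image.
  + by move=> _ [x /iX ix <-]; apply/idem_j.
  (* A cover in [T] stays a cover in [S]: the test idempotent [f] is itself covered by elements of
     [T], each below [e] and orthogonal to [X], hence zero. *)
  + move=> f jf fe fX0; have [Y [_ iY Yf cY]] := idem_cover jf.
    apply: cY => //.
    move=> _ [y Yy <-]; have ijy : idem (j y) by apply/idem_j; exact: iY.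
    have yf : f * j y = j y by rewrite (isidemC jf ijy); exact: Yf.
    rewrite yf -j0; congr j; apply: cX; first exact: iY.
      by apply/idem_le_j; exact: idem_le_trans (Yf _ Yy) fe.
    move=> x Xx; apply: j_inj; rewrite jM j0 -yf (isidemC jf ijy) -ismulA.
    by rewrite fX0 ?ismuls0 //; exists x.
Qed.

Lemma up_tight (F : set T) : tight_set F -> tight_set (up_filter F).
Proof.
move=> tF; split.
- by move=> e [].
- have [e Fe] := ts_neq0 tF; exists (j e); split; last exists e => //.
    by apply/idem_j; exact: (ts_idem tF).
  by apply/idem_le_j; exact: (ts_idem tF).
- move=> e f [ie [e' Fe' ee]] [jf [f' Ff' ff]]; split; first exact: idemM.
  exists (e' * f'); first exact: (ts_mul tF).
  have C : j e' * j f' = j f' * j e'.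
    by apply: isidemC; apply/idem_j; exact: (ts_idem tF).
  by rewrite /idem_le jM ismulA C -(ismulA (j f')) ee -C -ismulA ff.
- move=> e f [ie [e' Fe' ee]] jf ef; split=> //; exists e' => //.
  exact: idem_le_trans ee ef.
- move=> [_ [e' Fe']]; rewrite /idem_le ismuls0 -j0 => /j_inj e0.
  by apply: (ts_zero tF); rewrite e0.
- move=> e X [ie [e' Fe' ee]] fX iX cX.
  have [C HC] := idem_cover_choice.
  (* Members of [X] need not come from [T]; each is replaced by its finite cover [C x], and the
     union covers [e'] in [T]. *)
  have [|||y [x Xx Cy] Fy] := ts_cover tF Fe' (X := \bigcup_(x in X) C x).
  + by apply: bigcup_finite => // x /iX /HC[].
  + by move=> y [x /iX /HC[_ + _ _]]; exact.
  + move=> f jf fe fY; apply: j_inj; rewrite j0; apply: cX.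
    * exact/idem_j.
    * by apply: idem_le_trans ee; apply/idem_le_j.
    * move=> x Xx; have ix := iX _ Xx; have [_ iC Cx cC] := HC _ ix.
      have ijf : idem (j f) by apply/idem_j.
      apply: cC; [exact: idemM|exact: idem_leMr|].
      move=> _ [y Cy <-]; have ijy : idem (j y) by apply/idem_j; exact: iC.
      rewrite -ismulA (isidemC ix ijy) (Cx _ Cy) -jM fY ?j0 //.
      by exists x.
  exists x => //; split; first exact: iX.
  by exists y => //; have [_ _ + _] := HC _ (iX _ Xx); exact.
Qed.

Lemma up_filterK (F : set T) : tight_set F -> j @^-1` (up_filter F) = F.
Proof.
move=> tF; apply/seteqP; split=> e /=.
  by move=> [/idem_j ie [e' Fe' /idem_le_j]]; exact: (ts_up tF).
move=> Fe; have ie := ts_idem tF Fe; split; first exact/idem_j.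
by exists e => //; apply/idem_le_j.
Qed.

Lemma tight_down_le (F : set S) e : tight_set F -> F e ->
  exists2 e', F (j e') & idem_le (j e') e.
Proof.
move=> tF Fe; have [X [fX iX Xe cX]] := idem_cover (ts_idem tF Fe).
have [||_ [x Xx <-] Fx] := ts_cover tF Fe _ _ cX.
- exact: finite_image.
- by move=> _ [x /iX ix <-]; apply/idem_j.
- by exists x => //; exact: Xe.
Qed.

Lemma down_filterK (F : set S) : tight_set F -> up_filter (j @^-1` F) = F.
Proof.
move=> tF; apply/seteqP; split=> e.
  by move=> [ie [e' /= Fe' ee]]; exact: (ts_up tF) Fe' ie ee.
move=> Fe; split; first exact: (ts_idem tF).
exact: tight_down_le tF Fe.
Qed.

Lemma theta_up s (F : set T) : tight_set F ->
  theta (j s) (up_filter F) = up_filter (theta s F).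
Proof.
move=> tF; apply/seteqP; split=> f.
  move=> [jf [e [ie [e' Fe' ee]] ef]]; have ie' := ts_idem tF Fe'.
  have ije' : idem (j e') by apply/idem_j.
  split=> //; exists (s * e' * s^*).
    by split; [exact: idem_conj|exists e' => //; exact: idem_conj].
  rewrite !jM jV; apply: idem_le_trans ef; exact: idem_le_conj.
move=> [jf [f' [jf' [e Fe ef]] ff]]; split=> //; exists (j e).
  split; first by apply/idem_j; exact: (ts_idem tF).
  by exists e => //; apply/idem_le_j; exact: (ts_idem tF).
by rewrite -jV -!jM; apply: idem_le_trans ff; apply/idem_le_j.
Qed.

Lemma theta_down s (F : set S) : tight_set F ->
  j @^-1` theta (j s) F = theta s (j @^-1` F).
Proof.
move=> tF; rewrite -{1}(down_filterK tF) (theta_up _ (down_tight tF)).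
(* [theta] produces upward closed sets by definition, so restriction undoes [up_filter] here by a
   direct check, without proving [theta s] of a tight set tight. *)
apply/seteqP; split=> f /=.
  move=> [/idem_j jf [f' [jf' [e Fe ef]] /idem_le_j ff]]; split=> //.
  by exists e => //; exact: idem_le_trans ef ff.
move=> [jf [e Fe ef]]; split; first exact/idem_j.
by exists f; [split=> //; exists e|apply/idem_le_j].
Qed.

(** The domains of the restrictions in [j_dense] cover [s^* * s], so [F] contains one of them, and
    there [s] and [j t] agree. *)
Lemma germ_down_rep c s (F : set S) : is_germ c s F ->
  exists t e, [/\ F e, s * e = j t * e & is_germ c (j t) F].
Proof.
move=> g; have [/is_tightP tF Fs _] := g.
have [X [fX EX cX]] := j_dense s.
have [||_ [t Xt <-] Ft] := ts_cover tF Fs _ _ cX.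
- exact: finite_image.
- by move=> _ [t Xt <-]; apply/idem_j/idem_starl.
have E : s * j (t^* * t) = j t * j (t^* * t).
  by rewrite (EX _ Xt) -jM ismulA ismul_star.
by exists t, (j (t^* * t)); split=> //; exact: is_germ_rep g Ft E.
Qed.

Lemma is_germ_up c d t F t' : is_germ c t F -> is_germ d (j t) (up_filter F) ->
  is_germ c t' F -> is_germ d (j t') (up_filter F).
Proof.
move=> g gd g'; have [/is_tightP tF _ _] := g.
have [e Fe te] := is_germ_eq g g'.
apply: (is_germ_rep (e := j e) gd); last by rewrite -!jM te.
by have : (j @^-1` up_filter F) e by rewrite up_filterK.
Qed.

(** The idempotent on which [j t] and [j t'] agree may lie outside [T]; [tight_down_le] shrinks it
    to one from [T]. *)
Lemma is_germ_down c d t F t' : is_germ d (j t) F -> is_germ c t (j @^-1` F) ->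
  is_germ d (j t') F -> is_germ c t' (j @^-1` F).
Proof.
move=> g gc g'; have [/is_tightP tF _ _] := g.
have [e Fe te] := is_germ_eq g g'.
have [e' Fe' ee] := tight_down_le tF Fe.
apply: (is_germ_rep (e := e') gc) => //; apply: j_inj; rewrite !jM.
have ie := ts_idem tF Fe; have ie' := ts_idem tF Fe'.
by rewrite -ee (isidemC ie' ie) !ismulA te.
Qed.

(** A relation, since a germ has no preferred representative in [T]. It is then shown total, onto,
    functional and injective, and choice extracts both maps. *)
Definition germ_corr (c : tightGroupoid S) (d : tightGroupoid T) : Prop :=
  exists t F, is_germ c (j t) F /\ is_germ d t (j @^-1` F).

Lemma germ_corr_down c d t F : germ_corr c d -> is_germ c (j t) F ->
  is_germ d t (j @^-1` F).
Proof.
move=> [t' [F' [g' gd]]] g; have FF := is_germ_dom g g'; subst F'.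
exact: is_germ_down g' gd g.
Qed.

Lemma germ_corr_up c d t F : germ_corr c d -> is_germ d t F ->
  is_germ c (j t) (up_filter F).
Proof.
move=> [t' [F' [g' gd]]] g; have FF := is_germ_dom g gd; subst F.
have [/is_tightP tF _ _] := g'.
apply: (is_germ_up gd) => //; by rewrite down_filterK.
Qed.

Lemma germ_corr_total c : exists d, germ_corr c d.
Proof.
have [s [F [tF Fs E]]] := germ_valP c.
have [t [e [Fe se g]]] := germ_down_rep (And3 tF Fs E : is_germ c s F).
have [/is_tightP tF' Ft _] := g.
have [||d gd] := @is_germ_ex T t (j @^-1` F).
- exact/is_tightP/down_tight.
- by rewrite /= jM jV.
by exists d, t, F.
Qed.

Lemma germ_corr_onto d : exists c, germ_corr c d.
Proof.
have [t [F [/is_tightP tF Ft E]]] := germ_valP d.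
have U : up_filter F (j (t^* * t)).
  by have : (j @^-1` up_filter F) (t^* * t) by rewrite up_filterK.
have [||c gc] := @is_germ_ex S (j t) (up_filter F).
- exact/is_tightP/up_tight.
- by rewrite -jV -jM.
exists c, t, (up_filter F); split=> //; rewrite up_filterK //.
by split=> //; apply/is_tightP.
Qed.

Lemma germ_corr_fun c d d' : germ_corr c d -> germ_corr c d' -> d = d'.
Proof.
move=> [t [F [g gd]]] cd'; apply: is_germ_inj gd _.
exact: germ_corr_down cd' g.
Qed.

Lemma germ_corr_inj c c' d : germ_corr c d -> germ_corr c' d -> c = c'.
Proof.
move=> cd [t [F [g gd]]]; have [/is_tightP tF _ _] := g.
apply: is_germ_inj _ g; rewrite -(down_filterK tF).
exact: germ_corr_up cd gd.
Qed.

Lemma germ_mul_corr c1 c2 c3 d1 d2 d3 :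
  germ_corr c1 d1 -> germ_corr c2 d2 -> germ_corr c3 d3 ->
  germ_mul c1 c2 c3 <-> germ_mul d1 d2 d3.
Proof.
move=> h1 h2 h3; split=> -[t [s [F [g1 g2 g3]]]].
  have [s' [e [Fe se _]]] := germ_down_rep g2.
  have [t' [u [Fu tu _]]] := germ_down_rep g1.
  have [g1' g2' g3'] := germ_mul_rep g1 g2 g3 Fu tu Fe se.
  have [/is_tightP tF _ _] := g2.
  exists t', s', (j @^-1` F); rewrite -theta_down //; split.
  - exact: germ_corr_down h1 g1'.
  - exact: germ_corr_down h2 g2'.
  - by apply: germ_corr_down h3 _; rewrite jM.
have [/is_tightP tF _ _] := g2.
exists (j t), (j s), (up_filter F); rewrite theta_up // -jM; split.
- exact: germ_corr_up h1 g1.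
- exact: germ_corr_up h2 g2.
- exact: germ_corr_up h3 g3.
Qed.

Lemma germ_inv_corr c c' d d' : germ_corr c d -> germ_corr c' d' ->
  germ_inv c c' <-> germ_inv d d'.
Proof.
move=> h h'; split=> -[s [F [g g']]]; have [/is_tightP tF _ _] := g.
  have [s' [e [Fe se _]]] := germ_down_rep g.
  have [k k'] := germ_inv_rep g g' Fe se.
  exists s', (j @^-1` F); rewrite -theta_down //; split.
  - exact: germ_corr_down h k.
  - by apply: germ_corr_down h' _; rewrite jV.
exists (j s), (up_filter F); rewrite theta_up // -jV; split.
- exact: germ_corr_up h g.
- exact: germ_corr_up h' g'.
Qed.

Lemma germ_corr_continuous (f : tightGroupoid S -> tightGroupoid T) :
  (forall c, germ_corr c (f c)) -> continuous f.
Proof.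
move=> fP; apply: tightGroupoid_continuous => t V F c oV VF g.
have [e [X [Fe fX iX FX sub]]] := open_filter0_basis oV VF.
have gc := germ_corr_up (fP c) g; have [tU _ _] := gc.
have [H _ EH] := tU; rewrite EH in gc.
have HE x : filter_set H (j x) = filter_set F x.
  have [/is_tightP tF _ _] := g.
  by rewrite -EH -[in RHS](up_filterK tF).
pose W := [set H : filter0 S | filter_set H (j e) /\
                               forall f, (j @` X) f -> ~ filter_set H f].
have oW : open W.
  apply: open_filter0_subbase; exists (j e), (j @` X); split=> //.
  - exact/idem_j/(filter_idem Fe).
  - exact: finite_image.
  - by move=> _ [x /iX ix <-]; apply/idem_j.
pose B := [set c | exists2 H : filter0 S, W H & is_germ c (j t) (filter_set H)].
have oB : open B by apply: open_tightGroupoid_subbase; exists (j t), W.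
have : nbhs c B.
  apply: open_nbhs_nbhs; split=> //; exists H => //.
  by split; rewrite ?HE // => _ [x Xx <-]; rewrite HE; exact: FX.
apply: filterS => c' [H' [He' HX'] g'].
have gd := germ_corr_down (fP c') g'; have [[F1 _ EF] _ _] := gd.
exists F1; last by rewrite -EF.
apply: sub; rewrite -EF //= => x Xx; apply: HX'; exists x => //.
Qed.

(** Here the data of a basic open set of [S] must be pushed into [T]: the element [s], the required
    idempotent and the excluded ones. *)
Lemma germ_corr_continuousV (f : tightGroupoid T -> tightGroupoid S) :
  (forall d, germ_corr (f d) d) -> continuous f.
Proof.
move=> fP; apply: tightGroupoid_continuous => s V H d oV VH g.
have [t [e [He se gt]]] := germ_down_rep g.
have [e1 [X [He1 fX iX HX sub]]] := open_filter0_basis oV VH.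
have [/is_tightP tH _ _] := g.
have ie := ts_idem tH He; have ie1 := ts_idem tH He1.
(* A single [e'] from [T] lies below [e], where [s] agrees with [j t], and below the required
   idempotent [e1]. *)
have [e' He' ee'] := tight_down_le tH (ts_mul tH He He1).
have ije' := ts_idem tH He'.
have ee1 : idem_le (j e') e1 by apply: idem_le_trans ee' _; exact: idem_leMr.
have se' : s * j e' = j t * j e'.
  have : idem_le (j e') e by apply: idem_le_trans ee' _; exact: idem_leMl.
  by move=> <-; rewrite (isidemC ije' ie) !ismulA se.
have [C HC] := idem_cover_choice.
have gd := germ_corr_down (fP d) gt; have [[F tF EF] _ _] := gd.
rewrite EF in gd.
(* A tight filter contains [x] exactly when it contains the image of a member of [C x], so excluding
   [X] becomes excluding the finite set [Y]. *)
pose Y := \bigcup_(x in X) C x.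
pose W := [set F : filter0 T | filter_set F e' /\
                               forall f, Y f -> ~ filter_set F f].
have oW : open W.
  apply: open_filter0_subbase; exists e', Y; split=> //.
  - exact/idem_j.
  - by apply: bigcup_finite => // x /iX /HC[].
  - by move=> y [x /iX /HC[_ + _ _]]; exact.
pose B := [set d | exists2 F : filter0 T, W F & is_germ d t (filter_set F)].
have oB : open B by apply: open_tightGroupoid_subbase; exists t, W.
have : nbhs d B.
  apply: open_nbhs_nbhs; split=> //; exists F => //; split; rewrite -EF //=.
  move=> y [x Xx Cy] Hy; apply: (HX _ Xx); have ix := iX _ Xx.
  by apply: (ts_up tH Hy ix); have [_ _ + _] := HC _ ix; exact.
apply: filterS => d' [F' [Fe' FY'] g'].
have gc := germ_corr_up (fP d') g'; have [tU _ _] := gc.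
have [H' _ EH'] := tU; have /is_tightP tH' := tU.
have /is_tightP tF' : is_tight (filter_set F') by have [] := g'.
have FH x : up_filter (filter_set F') (j x) = filter_set F' x.
  by rewrite -[in RHS](up_filterK tF').
have He'' : up_filter (filter_set F') (j e') by rewrite FH.
exists H'; last by rewrite -EH'; apply: is_germ_rep gc He'' (esym se').
apply: sub; rewrite -EH'; first exact: (ts_up tH' He'').
move=> x Xx Hx; have ix := iX _ Xx; have [fC iC Cx cC] := HC _ ix.
have [||_ [y Cy <-]] := ts_cover tH' Hx _ _ cC.
- exact: finite_image.
- by move=> _ [y /iC iy <-]; apply/idem_j.
by rewrite FH; apply: FY'; exists x.
Qed.

Theorem dense_subsemigroup_iso : exists Phi : tightGroupoid S -> tightGroupoid T,
  (forall c t F, is_germ c (j t) F -> is_germ (Phi c) t (j @^-1` F)) /\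
  tightGroupoid_iso Phi.
Proof.
have [Phi PhiP] := choice germ_corr_total.
have [Psi PsiP] := choice germ_corr_onto.
exists Phi; split=> [c t F|]; first exact: germ_corr_down.
split; first by move=> *; exact: germ_mul_corr.
  by move=> *; exact: germ_inv_corr.
exists Psi; split.
- by move=> c; exact: germ_corr_inj (PsiP _) (PhiP _).
- by move=> d; exact: germ_corr_fun (PhiP _) (PsiP _).
- exact: germ_corr_continuous.
- exact: germ_corr_continuousV.
Qed.

End DenseSubsemigroup.

(** * Boundary paths as sets of initial segments *)

Section BoundarySets.
Variables (k : nat) (L : kgraph k).
Implicit Types (a b c l m mu nu y : L) (M X : set L) (n p q : dg k).

(** By [common_ext] this amounts to [Lmin mu nu] being nonempty, but no degree occurs. *)
Definition compatible mu nu : Prop :=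
  exists a b, [/\ sc mu = rg a, sc nu = rg b & cmp mu a = cmp nu b].

(* The set of initial segments of a boundary path, axiomatised without degrees;
   the last clause rephrases the condition on FE sets. *)
Record boundary_set M : Prop := {
  bs_neq0 : M !=set0;
  bs_prefix : forall a b, sc a = rg b -> M (cmp a b) -> M a;
  bs_directed : forall a b, M a -> M b -> exists a' b',
    [/\ sc a = rg a', sc b = rg b', cmp a a' = cmp b b' & M (cmp a a')];
  bs_meet : forall a X, M a -> finite_set X ->
    (forall y, sc a = rg y -> exists2 mu, X mu & compatible (cmp a y) mu) ->
    exists2 mu, X mu & M mu
}.

Lemma dgle_refl n : dgle n n. Proof. by move=> i. Qed.

Lemma dg0_le n : dgle dg0 n. Proof. by move=> i. Qed.

Lemma edg0_le (d : edg k) : edgle dg0 d.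
Proof. by move=> i; case: (d i). Qed.

Lemma edgle_trans p q (d : edg k) : dgle p q -> edgle q d -> edgle p d.
Proof.
move=> pq qd i; have := qd i; case: (d i) => // b; exact: leq_trans.
Qed.

Lemma edgleV p q (d : edg k) : edgle p d -> edgle q d -> edgle (dgV p q) d.
Proof.
move=> pd qd i; have := pd i; have := qd i; case: (d i) => // b.
by rewrite /dgV geq_max => -> ->.
Qed.

Lemma edgle_sub p q (d : edg k) : edgle q (edgD p d) <-> edgle (dgB q p) d.
Proof.
by split=> h i; have := h i; rewrite /edgD; case: (d i) => //= b;
  rewrite /dgB leq_subLR.
Qed.

Lemma deg_prefix a b : sc a = rg b -> dgle (deg a) (deg (cmp a b)).
Proof. by move=> ab i; rewrite deg_cmp // /dgD leq_addr. Qed.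

Lemma deg_rg a : deg (rg a) = dg0.
Proof. by rewrite -[rg a]sc_rg deg_sc. Qed.

Lemma common_ext_fst mu nu a b : sc mu = rg a -> sc nu = rg b ->
  cmp mu a = cmp nu b -> Lmin mu nu !=set0.
Proof. by move=> ma nb /(common_ext ma nb)[p [y []]]; exists p. Qed.

Lemma boundary_set_uniq M a b : boundary_set M -> M a -> M b ->
  deg a = deg b -> a = b.
Proof.
move=> bM Ma Mb; have [a' [b' [aa bb E _]]] := bs_directed bM Ma Mb.
by move=> /(factor_uniq aa bb E)[].
Qed.

Lemma segmentE a b c : sc a = rg b -> sc b = rg c ->
  segment (cmp a (cmp b c)) (deg a) (dgD (deg a) (deg b)) = b.
Proof.
move=> ab bc; rewrite /segment.
have dB : dgB (dgD (deg a) (deg b)) (deg a) = deg b.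
  by apply/funext => i; rewrite /dgB /dgD addKn.
(* Unique factorisation determines the segment, so the default of [xget] never appears. *)
apply: xget_unique => [|b']; first by exists a, c; rewrite dB.
move=> [a' [c' [da' db' ab' bc' E]]].
have [? E'] := factor_uniq (rg_cmpE ab bc) (rg_cmpE ab' bc') E (esym da').
subst a'; have db : deg b = deg b' by rewrite db' dB.
by have [-> _] := factor_uniq bc bc' E' db.
Qed.

Lemma segment0 a b : sc a = rg b -> segment (cmp a b) dg0 (deg a) = a.
Proof.
move=> ab; have := @segmentE (rg a) a b (sc_rg a) ab.
by rewrite cmpA ?sc_rg // cmp_rg deg_rg.
Qed.

Definition path_set (x : prepath L) : set L :=
  [set l | exists2 n, edgle n (pdeg x) & l = pmor x dg0 n].

Lemma path_split (x : prepath L) p q : is_path x -> dgle p q ->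
  edgle q (pdeg x) ->
  sc (pmor x dg0 p) = rg (pmor x p q) /\
  pmor x dg0 q = cmp (pmor x dg0 p) (pmor x p q).
Proof.
move=> px pq qx; have px' := edgle_trans pq qx.
rewrite (path_rg px pq qx) (path_sc px (dg0_le p) px'); split=> //.
exact (path_cmp px (dg0_le p) pq qx).
Qed.

Lemma deg_path0 (x : prepath L) n : is_path x -> edgle n (pdeg x) ->
  deg (pmor x dg0 n) = n.
Proof.
move=> px nx; rewrite (path_deg px (dg0_le n) nx).
by apply/funext => i; rewrite /dgB subn0.
Qed.

Lemma path_rangeE (x : prepath L) n : is_path x -> edgle n (pdeg x) ->
  rg (pmor x dg0 n) = path_range x.
Proof. by move=> px nx; exact (path_rg px (dg0_le n) nx). Qed.

Lemma path_set_prefix (x : prepath L) a b : is_path x -> sc a = rg b ->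
  path_set x (cmp a b) -> path_set x a.
Proof.
move=> px ab [n nx E].
have an : dgle (deg a) n by rewrite -(deg_path0 px nx) -E; exact: deg_prefix.
exists (deg a); first exact: edgle_trans an nx.
have [s E'] := path_split px an nx.
have D : deg a = deg (pmor x dg0 (deg a)).
  by rewrite deg_path0 //; exact: edgle_trans an nx.
by have [] := factor_uniq ab s (etrans E E') D.
Qed.

Lemma boundary_path_set (x : prepath L) : finitely_aligned L ->
  boundary_path x -> boundary_set (path_set x).
Proof.
move=> fa [px bx]; have pre a b := @path_set_prefix x a b px.
split=> //.
- by exists (pmor x dg0 dg0); exists dg0 => //; exact: edg0_le.
- move=> _ _ [p hp ->] [q hq ->]; have hpq := edgleV hp hq.
  have lp : dgle p (dgV p q) by move=> i; exact: leq_maxl.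
  have lq : dgle q (dgV p q) by move=> i; exact: leq_maxr.
  have [s1 E1] := path_split px lp hpq; have [s2 E2] := path_split px lq hpq.
  exists (pmor x p (dgV p q)), (pmor x q (dgV p q)); rewrite -E1 -E2.
  by split=> //; exists (dgV p q).
- move=> _ X [n nx ->] fX HX; set a := pmor x dg0 n.
  have san : sc a = pmor x n n by exact (path_sc px (dg0_le n) nx).
  (* Minimal continuations of [a] that bring it past some member of [X]: if the path runs through
     one of them, it has passed that member. *)
  pose Y := [set beta | exists2 mu, X mu & exists c, Lmin a mu (beta, c)].
  have hit beta : Y beta -> path_set x (cmp a beta) -> exists2 mu, X mu & path_set x mu.
    move=> [mu Xmu [c [/= ab mc E _]]] H; exists mu => //.
    by apply: (pre mu c) => //; rewrite -E.
  (* Sets in [FE] exclude the vertex. If [Y] contains it, then [a] already extends a member of [X];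
     otherwise [Y] is a legitimate [FE] set. *)
  have [[beta Yb b0]|nY] := pselect (exists2 beta, Y beta & deg beta = dg0).
    apply: (hit beta Yb); have [_ _ [c [/= ab _ _ _]]] := Yb.
    have [_ rb] := deg0_sc b0; rewrite -rb -ab cmp_sc; by exists n.
  have [|beta Yb [nb Eb]] := bx n Y nx; last first.
    apply: (hit beta Yb); exists (dgD n (deg beta)) => //.
    have nn : dgle n (dgD n (deg beta)) by move=> i; exact: leq_addr.
    by have [_ ->] := path_split px nn nb; rewrite Eb.
  split.
  + apply: (@sub_finite_set _ _ (\bigcup_(mu in X) (fst @` Lmin a mu))).
      by move=> beta [mu Xmu [c H]]; exists mu => //; exists (beta, c).
    by apply: bigcup_finite => // mu _; exact/finite_image/fa.
  + move=> beta Yb; have [_ _ [c [/= ab _ _ _]]] := Yb; split; first by rewrite -ab san.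
    by move=> E; apply: nY; exists beta => //; rewrite E -san deg_sc.
  + move=> y ry; have ay : sc a = rg y by rewrite san ry.
    have [mu Xmu [u [w [yu mw E]]]] := HX y ay.
    rewrite sc_cmp // in yu; rewrite -cmpA // in E.
    have [[beta c] [t [Lp /= bt _ E1 _]]] := common_ext (rg_cmpE ay yu) mw E.
    exists beta; first by exists mu => //; exists c.
    exact: common_ext_fst yu bt E1.
Qed.

(** * Concatenation and shift of sets of initial segments *)

Definition concat_set nu M : set L :=
  [set l | exists m b, [/\ M m, sc l = rg b & cmp nu m = cmp l b]].

Definition shift_set nu M : set L := [set a | sc nu = rg a /\ M (cmp nu a)].

Lemma boundary_shift_set nu M : boundary_set M -> M nu ->
  boundary_set (shift_set nu M).
Proof.
move=> bM Mnu; split.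
- by exists (sc nu); split; rewrite ?rg_sc ?cmp_sc.
- move=> a b ab [nab M1]; have na : sc nu = rg a by rewrite nab rg_cmp.
  split=> //; apply: (bs_prefix bM (b := b)); first by rewrite sc_cmp.
  by rewrite -cmpA.
- move=> a b [na Ma] [nb Mb].
  have [a' [b' [aa bb E M1]]] := bs_directed bM Ma Mb.
  rewrite !sc_cmp // in aa bb; rewrite -!cmpA // in E M1.
  have ra : sc nu = rg (cmp a a') by rewrite rg_cmp.
  have rb : sc nu = rg (cmp b b') by rewrite rg_cmp.
  by exists a', b'; split=> //; exact: cmpI ra rb E.
- move=> a X [na Ma] fX HX.
  (* The composite of [nu] and [mu] is meaningful only for these [mu]; anything compatible with
     [cmp a y] is among them. *)
  pose X' := X `&` [set mu | sc nu = rg mu].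
  have [||_ [mu [Xmu nmu] <-] Mmu] := bs_meet bM Ma (X := cmp nu @` X').
  + by apply: finite_image; exact: finite_setIl.
  + move=> y; rewrite sc_cmp // => ay; have [mu Xmu [u [w [ayu mw E]]]] := HX y ay.
    have nay : sc nu = rg (cmp a y) by rewrite rg_cmp.
    have nmu : sc nu = rg mu by rewrite -(rg_cmp mw) -E !rg_cmp.
    exists (cmp nu mu); first by exists mu.
    exists u, w; rewrite -(cmpA na ay) (sc_cmp nay) (sc_cmp nmu).
    by split=> //; rewrite -(cmpA nay ayu) E cmpA.
  by exists mu.
Qed.

Lemma concat_shift_set nu M : boundary_set M -> M nu ->
  concat_set nu (shift_set nu M) = M.
Proof.
move=> bM Mnu; apply/seteqP; split=> l.
  by move=> [m [b [[_ Mm] lb E]]]; apply: (bs_prefix bM lb); rewrite -E.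
move=> Ml; have [a [b [na lb E M1]]] := bs_directed bM Mnu Ml.
by exists a, b.
Qed.

Lemma boundary_concat_set nu M : finitely_aligned L -> boundary_set M ->
  (forall m, M m -> sc nu = rg m) -> boundary_set (concat_set nu M).
Proof.
move=> fa bM nM.
have pre a b : sc a = rg b -> concat_set nu M (cmp a b) -> concat_set nu M a.
  move=> ab [m [c [Mm abc E]]]; rewrite sc_cmp // in abc.
  by exists m, (cmp b c); split=> //; [exact: rg_cmpE|rewrite E -cmpA].
have MM m : M m -> concat_set nu M (cmp nu m).
  move=> Mm; have nm := nM _ Mm.
  by exists m, (sc m); split; rewrite ?sc_cmp ?rg_sc // -cmpA ?cmp_sc ?rg_sc.
split=> //.
- by have [m /MM Mm] := bs_neq0 bM; exists (cmp nu m).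
- move=> a b [m [c [Mm ac E]]] [m' [c' [Mm' bc E']]].
  have [d [d' [md md' D M1]]] := bs_directed bM Mm Mm'.
  have nm := nM _ Mm; have nm' := nM _ Mm'.
  have cd : sc c = rg d by rewrite -md -(sc_cmp nm) E sc_cmp.
  have cd' : sc c' = rg d' by rewrite -md' -(sc_cmp nm') E' sc_cmp.
  have F : cmp nu (cmp m d) = cmp a (cmp c d) by rewrite cmpA // E -cmpA.
  have F' : cmp nu (cmp m' d') = cmp b (cmp c' d') by rewrite cmpA // E' -cmpA.
  exists (cmp c d), (cmp c' d'); split; rewrite ?rg_cmp //.
    by rewrite -F -F' D.
  by rewrite -F; exact: MM.
- move=> a X [m [c [Mm ac E]]] fX HX; have nm := nM _ Mm.
  have cm : sc c = sc m by rewrite -(sc_cmp nm) E sc_cmp.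
  (* A set testing [a], a prefix of [nu m], is turned into one testing [m] in [M]: minimal
     continuations of [nu m] past a member of [X], finitely many by finite alignment. *)
  pose Y := \bigcup_(mu in X) (fst @` Lmin (cmp nu m) mu).
  have [||_ [_ [mu Xmu [[beta g] [/= mb mg F _] <-]] <-] M1] :=
      bs_meet bM Mm (X := cmp m @` Y).
  + by apply/finite_image/bigcup_finite => // mu _; exact/finite_image/fa.
  + move=> y my; have cy : sc c = rg y by rewrite cm.
    have [|mu Xmu [u [w [yu mw F]]]] := HX (cmp c y); first exact: rg_cmpE.
    rewrite !sc_cmp ?rg_cmp // in yu; rewrite cmpA // -E -cmpA // in F; last first.
      by rewrite sc_cmp.
    have nmyu : sc (cmp nu m) = rg (cmp y u) by rewrite sc_cmp // rg_cmp.
    have [[beta g] [t [Lp /= bt _ E1 _]]] := common_ext nmyu mw F.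
    have mb : sc m = rg beta by have [/= H _ _ _] := Lp; rewrite sc_cmp in H.
    exists (cmp m beta); first by exists beta => //; exists mu => //; exists (beta, g).
    by exists u, t; rewrite !sc_cmp //; split=> //; rewrite -!cmpA // E1.
  exists mu => //; apply: (pre mu g) => //; rewrite sc_cmp // in mb.
  by rewrite -F -cmpA //; exact: MM.
Qed.

Lemma path_set_concat nu (x : prepath L) : is_path x -> path_range x = sc nu ->
  path_set (path_concat nu x) = concat_set nu (path_set x).
Proof.
move=> px xnu.
have rx n : edgle n (pdeg x) -> sc nu = rg (pmor x dg0 n).
  by move=> nx; rewrite path_rangeE.
(* The path [nu x] from 0 to [n] is the prefix of degree [n] of [nu x(0, n - deg nu)], which is long
   enough even where the subtraction truncates to 0. *)
have key n : edgle (dgB n (deg nu)) (pdeg x) -> exists a b, [/\ deg a = n,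
    sc a = rg b, cmp nu (pmor x dg0 (dgB n (deg nu))) = cmp a b
    & pmor (path_concat nu x) dg0 n = a].
  move=> nx; have [a [b [da ab E]]] : exists a b, [/\ deg a = n, sc a = rg b
      & cmp nu (pmor x dg0 (dgB n (deg nu))) = cmp a b].
    apply: factor; rewrite (deg_cmp (rx _ nx)) deg_path0 // => i.
    by rewrite /dgD /dgB -leq_subLR.
  by exists a, b; split=> //=; rewrite E -da segment0.
apply/seteqP; split=> l.
  move=> [n /edgle_sub nx ->]; have [a [b [_ ab E ->]]] := key n nx.
  by exists (pmor x dg0 (dgB n (deg nu))), b; split=> //; exists (dgB n (deg nu)).
move=> [_ [b [[q qx ->] lb E]]].
have lq : dgle (dgB (deg l) (deg nu)) q.
  move=> i; rewrite /dgB leq_subLR; have := deg_prefix lb i.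
  by rewrite -E (deg_cmp (rx _ qx)) deg_path0.
have nx := edgle_trans lq qx; exists (deg l); first exact/edgle_sub.
have [a [c [da ac E' ->]]] := key _ nx.
have [s E2] := path_split px lq qx.
have cs : sc c = rg (pmor x (dgB (deg l) (deg nu)) q).
  by rewrite -s -(sc_cmp (rx _ nx)) E' sc_cmp.
have := E; rewrite E2 (cmpA (rx _ nx) s) E' -cmpA // => E3.
by have [-> _] := factor_uniq (rg_cmpE ac cs) lb E3 da.
Qed.

(** Each coordinate of [d] is the supremum of the degrees occurring in [M], with [None] when
    unbounded. Elements large in single coordinates are joined by directedness, and prefixes then
    realise every smaller degree. *)
Lemma boundary_set_deg M : boundary_set M -> exists d : edg k, forall n,
  edgle n d <-> exists2 a, M a & deg a = n.
Proof.
move=> bM.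
have /choice[d dP] : forall i : 'I_k, exists o : option nat, match o with
    | Some B => (exists2 a, M a & deg a i = B) /\ forall a, M a -> (deg a i <= B)%N
    | None => forall B : nat, exists2 a, M a & (B <= deg a i)%N end.
  move=> i; have [[B HB]|nB] := pselect (exists B, forall a, M a -> (deg a i <= B)%N).
    pose P (c : nat) := `[< exists2 a, M a & deg a i = c >].
    have exP : exists c : nat, P c.
      by have [a Ma] := bs_neq0 bM; exists (deg a i); apply/asboolP; exists a.
    have ubP (c : nat) : P c -> (c <= B)%N by move=> /asboolP[a /HB + <-].
    have [b /asboolP Pb bmax] := ex_maxnP exP ubP.
    by exists (Some b); split=> // a Ma; apply: bmax; apply/asboolP; exists a.
  exists None => B; apply: contrapT => nb; apply: nB; exists B => a Ma.
  by rewrite leqNgt; apply/negP => ba; apply: nb; exists a => //; exact: ltnW.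
exists d => n; split=> [nd|[a Ma <-] i]; last first.
  by have := dP i; case: (d i) => // b [_]; exact.
have /choice[f fP] : forall i, exists a, M a /\ (n i <= deg a i)%N.
  move=> i; have := nd i; have := dP i.
  by case: (d i) => [b [[a Ma <-] _]|/(_ (n i))[a Ma]] ?; exists a.
have [a [Ma na]] : exists a, M a /\ forall i, i \in enum 'I_k -> (n i <= deg a i)%N.
  elim: (enum 'I_k) => [|i s [a [Ma IH]]].
    by have [a Ma] := bs_neq0 bM; exists a.
  have [Mf nf] := fP i; have [a' [b' [aa bb E M1]]] := bs_directed bM Ma Mf.
  exists (cmp a a'); split=> // i'; rewrite inE => /orP[/eqP ->|/IH h].
    by rewrite E; apply: leq_trans nf _; exact: deg_prefix.
  by apply: leq_trans h _; exact: deg_prefix.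
have [|b [c [db bc E]]] := @factor _ _ a n.
  by move=> i; apply: na; rewrite mem_enum.
by exists b => //; apply: (bs_prefix bM bc); rewrite -E.
Qed.

(** The path is read off from [pt n], the unique member of [M] of degree [n]; outside [d] the value
    of [pt] is arbitrary. *)
Lemma boundary_set_path M v : boundary_set M -> (forall m, M m -> rg m = v) ->
  exists x, [/\ boundary_path x, path_range x = v & path_set x = M].
Proof.
move=> bM Mv; have [d dP] := boundary_set_deg bM.
have /choice[pt ptP] : forall n, exists a, edgle n d -> M a /\ deg a = n.
  move=> n; have [/dP[a Ma da]|nn] := pselect (edgle n d); first by exists a.
  by have [a _] := bs_neq0 bM; exists a.
have Mpt n : edgle n d -> M (pt n) by move=> /ptP[].
have dpt n : edgle n d -> deg (pt n) = n by move=> /ptP[].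
pose x := Prepath d (fun p q => segment (pt q) p q).
have xP p q : dgle p q -> edgle q d -> [/\ sc (pt p) = rg (pmor x p q),
    pt q = cmp (pt p) (pmor x p q) & deg (pmor x p q) = dgB q p].
  move=> pq qd; have pd := edgle_trans pq qd.
  have [|a [c [da ac E]]] := @factor _ _ (pt q) p; first by rewrite dpt.
  have ap : a = pt p.
    apply: (boundary_set_uniq bM _ (Mpt _ pd)); last by rewrite da dpt.
    by apply: (bs_prefix bM ac); rewrite -E; exact: Mpt.
  subst a; have dc : deg c = dgB q p.
    rewrite -(dpt _ qd) E deg_cmp // dpt //.
    by apply/funext => i; rewrite /dgB /dgD addKn.
  suff -> : pmor x p q = c by split.
  rewrite /=; have := @segmentE (pt p) c (sc c) ac (esym (rg_sc c)).
  rewrite cmp_sc -E da dc => H; rewrite -[RHS]H; congr segment.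
  by apply/funext => i; rewrite /dgB /dgD subnKC.
have xpp p : edgle p d -> pmor x p p = sc (pt p).
  move=> pd; have [s E _] := xP p p (dgle_refl p) pd.
  by apply: (cmpI (a := pt p)) => //; rewrite ?rg_sc // cmp_sc -E.
have x0 n : edgle n d -> pmor x dg0 n = pt n.
  move=> nd; have [s E _] := xP dg0 n (dg0_le n) nd.
  have [s0 _] := deg0_sc (dpt _ (edg0_le d)).
  by rewrite E -s0 s cmp_rg.
have px : is_path x.
  split.
  - by move=> p q pq qd; have [] := xP p q pq qd.
  - move=> p q pq qd; have [s _ _] := xP p q pq qd.
    by rewrite -s -xpp //; exact: edgle_trans qd.
  - move=> p q pq qd; have [s E _] := xP p q pq qd.
    by rewrite -(sc_cmp s) -E -xpp.
  - move=> p q t pq qt td; have qd := edgle_trans qt td.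
    have pt' : dgle p t by move=> i; exact: leq_trans (pq i) (qt i).
    have [s1 E1 _] := xP p q pq qd; have [s2 E2 _] := xP q t qt td.
    have [s3 E3 _] := xP p t pt' td.
    have s12 : sc (pmor x p q) = rg (pmor x q t) by rewrite -s2 E1 sc_cmp.
    apply: (cmpI s3); first exact: rg_cmpE.
    by rewrite -E3 E2 E1 -(cmpA s1 s12).
have xM : path_set x = M.
  apply/seteqP; split=> l; first by move=> [n nd ->]; rewrite x0 //; exact: Mpt.
  move=> Ml; have ld : edgle (deg l) d by apply/dP; exists l.
  exists (deg l) => //; rewrite x0 //.
  by apply: (boundary_set_uniq bM Ml (Mpt _ ld)); rewrite dpt.
exists x; split=> //; last first.
  have nd := edg0_le d; rewrite /path_range x0 //.
  by have [_ <-] := deg0_sc (dpt _ nd); exact/Mv/Mpt.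
(* An [FE] set at x(p) becomes a set that [M] must meet after prefixing by [pt p]; uniqueness in
   each degree then locates its member on the path. *)
split=> // p X pd [fX sX HX]; have [||_ [mu Xmu <-] Mmu] :=
    bs_meet bM (Mpt _ pd) (X := cmp (pt p) @` X).
- exact: finite_image.
- move=> y py; have [|mu Xmu [[a b] [/= ya mb E _]]] := HX y.
    by rewrite -py xpp.
  have pm : sc (pt p) = rg mu by have [-> _] := sX _ Xmu; rewrite xpp.
  exists (cmp (pt p) mu); first by exists mu.
  by exists a, b; rewrite !sc_cmp // -!cmpA // E.
have pm : sc (pt p) = rg mu by have [-> _] := sX _ Xmu; rewrite xpp.
have Dm : deg (cmp (pt p) mu) = dgD p (deg mu) by rewrite deg_cmp // dpt.
have qd : edgle (dgD p (deg mu)) d by apply/dP; exists (cmp (pt p) mu).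
exists mu => //; split=> //.
have pq : dgle p (dgD p (deg mu)) by move=> i; exact: leq_addr.
have [s E _] := xP _ _ pq qd.
apply: (cmpI s pm); rewrite -E; apply: boundary_set_uniq bM (Mpt _ qd) Mmu _.
by rewrite dpt.
Qed.

End BoundarySets.

(** * The two inverse semigroups of a self-similar k-graph *)

Section PartialBijectionRestriction.
Variable X : Type.
Implicit Types f t : pbij X.

Lemma pbcomp_restrict f t : (forall x y, t x y -> f x y) ->
  pbcomp f (pbcomp (pbinv t) t) = t.
Proof.
move=> tf; apply: pbijP => x y; split=> /=.
- move=> [z [u txu tzu] fzy]; have ? := pb_inj tzu txu; subst z.
  by rewrite (pb_fun fzy (tf _ _ txu)).
- by move=> txy; exists x; [exists y|exact: tf].
Qed.

End PartialBijectionRestriction.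

Section SelfSimilarTight.
Variables (k : nat) (L : kgraph k) (G : groupType) (A : selfSimilar L G).
Local Notation act := (act A).
Local Notation coc := (coc A).
Local Notation S := (SGL A).
Local Notation "a * b" := (ismul a b).
Implicit Types (E F : S) (l mu nu a b y : L) (M : set L).

(** First coordinates of the domain of [SGL_rho E]. The group coordinate is unrestricted there, so
    subsets of Lambda suffice to describe idempotents. *)
Definition dom E l : Prop := exists mu g nu y,
  [/\ SGL_val E (mu, g, nu), sc nu = rg y & l = cmp nu y].

Lemma SGL_rhoE E F : SGL_rho (E * F : S) = pbcomp (SGL_rho E) (SGL_rho F).
Proof. exact: SGL_rhoM. Qed.

Lemma SGL_rho_star E : SGL_rho (isstar E : S) = pbinv (SGL_rho E).
Proof. exact: SGL_rhoV. Qed.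

Lemma SGL_rho_idem E : idem E -> pbcomp (SGL_rho E) (SGL_rho E) = SGL_rho E.
Proof. by move=> iE; rewrite -SGL_rhoE iE. Qed.

Lemma SGL_rho_dom E c c' : SGL_rho E c c' -> dom E c.1.
Proof. by move=> [mu [g [nu [y [H1 H2 H3 _]]]]]; exists mu, g, nu, y. Qed.

Lemma dom_SGL_rho E l g : dom E l -> exists c, SGL_rho E (l, g) c.
Proof.
by move=> [mu [h [nu [y [H1 H2 ->]]]]];
  exists (cmp mu (act h y), (coc h y * g)%g), mu, h, nu, y.
Qed.

Lemma idem_rho E l g : idem E -> dom E l -> SGL_rho E (l, g) (l, g).
Proof.
move=> iE /(dom_SGL_rho g)[c Hc].
by rewrite {2}(pbidem_id (SGL_rho_idem iE) Hc).
Qed.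

Lemma dom_prefix E mu g nu : SGL_val E (mu, g, nu) -> dom E nu.
Proof.
by move=> H; exists mu, g, nu, (sc nu); rewrite rg_sc cmp_sc.
Qed.

(** An idempotent acts as a partial identity, and the triple sends (nu, e) to (mu, g). *)
Lemma idem_triple E mu g nu : idem E -> SGL_val E (mu, g, nu) ->
  mu = nu /\ g = 1%g.
Proof.
move=> iE H; have [_ /(_ _ _ _ H) s _] := SGL_valP E.
have : SGL_rho E (nu, 1%g) (mu, g).
  exists mu, g, nu, (sc nu); split; rewrite ?rg_sc ?cmp_sc //.
  by rewrite -s cmp_sc coc_obj ?mulg1 // /is_object rg_sc.
by move=> /(pbidem_id (SGL_rho_idem iE))[-> ->].
Qed.

Lemma idem_dom E l : idem E -> dom E l ->
  exists nu y, [/\ SGL_val E (nu, 1%g, nu), sc nu = rg y & l = cmp nu y].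
Proof.
move=> iE [mu [g [nu [y [H ny ->]]]]].
by have [? ?] := idem_triple iE H; subst mu g; exists nu, y.
Qed.

Lemma dom_extend E l y : sc l = rg y -> dom E l -> dom E (cmp l y).
Proof.
move=> ly [mu [g [nu [z [H nz E']]]]]; exists mu, g, nu, (cmp z y).
have zy : sc z = rg y by rewrite -ly E' sc_cmp.
by split; rewrite ?rg_cmp // E' cmpA.
Qed.

Lemma dom_mul E F l : idem E -> idem F -> dom (E * F : S) l <-> dom E l /\ dom F l.
Proof.
move=> iE iF; split=> [/(dom_SGL_rho 1%g)[c]|]; last first.
  move=> [/(idem_rho 1%g iE) HE /(idem_rho 1%g iF) HF].
  suff : SGL_rho (E * F : S) (l, 1%g) (l, 1%g) by move=> /SGL_rho_dom.
  by rewrite SGL_rhoE; exists (l, 1%g).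
rewrite SGL_rhoE => -[c' HF HE].
have e := pbidem_id (SGL_rho_idem iF) HF; subst c'.
by split; [exact: SGL_rho_dom HE|exact: SGL_rho_dom HF].
Qed.

Lemma idem_le_dom E F : idem E -> idem F ->
  idem_le E F <-> (forall l, dom E l -> dom F l).
Proof.
move=> iE iF; split=> [EF l|EF]; first by rewrite -EF => /dom_mul[].
apply: SGL_rho_inj; rewrite SGL_rhoE; apply: pbijP => c c'; split=> /=.
  by move=> [d HF HE]; have e := pbidem_id (SGL_rho_idem iF) HF; subst d.
move=> HE; exists c => //; have := EF _ (SGL_rho_dom HE).
by case: c {HE} => l g; exact: idem_rho.
Qed.

Lemma eq_zero_dom E : (forall l, ~ dom E l) -> E = iszero S.
Proof.
move=> nE; apply: SGL_rho_inj; rewrite (SGL_rho0 A : SGL_rho (iszero S) = _).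
by apply: pbijP => c c'; split=> // /SGL_rho_dom /nE.
Qed.

Lemma dom_zero l : ~ dom (iszero S) l.
Proof. by move=> [mu [g [nu [y []]]]]. Qed.

Definition vsingle l : S :=
  SGL_single (esym (act1 A (sc l)) : sc l = act 1%g (sc l)).

Lemma dom_single mu g nu (h : sc mu = act g (sc nu)) l :
  dom (SGL_single h) l <-> exists2 y, sc nu = rg y & l = cmp nu y.
Proof.
split=> [[mu' [g' [nu' [y [[_ _ ->] H ->]]]]]|[y H ->]]; first by exists y.
by exists mu, g, nu, y.
Qed.

Lemma dom_vsingle l l' : dom (vsingle l) l' <-> exists2 y, sc l = rg y & l' = cmp l y.
Proof. exact: dom_single. Qed.

Lemma dom_vsingle_self l : dom (vsingle l) l.
Proof. by apply/dom_vsingle; exists (sc l); rewrite ?rg_sc ?cmp_sc. Qed.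

Lemma vsingle_idem l : idem (vsingle l).
Proof.
have id c c' : SGL_rho (vsingle l) c c' -> c = c'.
  move=> [mu [g [nu [y [[-> -> ->] ly E ->]]]]].
  by rewrite act1 coc1 mul1g -E -surjective_pairing.
apply: SGL_rho_inj; rewrite SGL_rhoE; apply: pbijP => c c'; split=> /=.
  by move=> [d /id ->].
by move=> H; exists c => //; rewrite {2}(id _ _ H).
Qed.

Lemma vsingle_le l E : idem E -> idem_le (vsingle l) E <-> dom E l.
Proof.
move=> iE; rewrite idem_le_dom //; last exact: vsingle_idem.
split=> [|El l' /dom_vsingle[y ly ->]]; first by apply; exact: dom_vsingle_self.
exact: dom_extend.
Qed.

(** * Tight filters of [SGL] and boundary sets *)

Definition dom_filter M : set S :=
  [set E | idem E /\ exists2 l, M l & dom E l].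

(** The source of the triple covering [l] is a prefix of [l], hence in [M]; this matches
    [dom_filter] with the shape of [SGL_filter]. *)
Lemma dom_filterE M E : boundary_set M -> idem E ->
  dom_filter M E <-> exists2 l, M l & SGL_val E (l, 1%g, l).
Proof.
move=> bM iE; split=> [[_ [l Ml /(idem_dom iE)[nu [y [H ny El]]]]]|[l Ml H]].
  by exists nu => //; apply: (bs_prefix bM ny); rewrite -El.
by split=> //; exists l => //; exact: dom_prefix H.
Qed.

Lemma dom_filter_vsingle M l : boundary_set M -> dom_filter M (vsingle l) <-> M l.
Proof.
move=> bM; split=> [[_ [l' Ml' /dom_vsingle[y ly E]]]|Ml].
  by apply: (bs_prefix bM ly); rewrite -E.
by split; [exact: vsingle_idem|exists l => //; exact: dom_vsingle_self].
Qed.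

Lemma finite_sources E : finite_set [set nu | exists mu g, SGL_val E (mu, g, nu)].
Proof.
apply: (@sub_finite_set _ _ (snd @` SGL_val E)).
  by move=> nu [mu [g H]]; exists (mu, g, nu).
by apply: finite_image; have [] := SGL_valP E.
Qed.

Lemma boundary_set_tight M : boundary_set M -> tight_set (dom_filter M).
Proof.
move=> bM; split.
- by move=> E [].
- by have [l Ml] := bs_neq0 bM; exists (vsingle l); apply/dom_filter_vsingle.
- move=> E F [iE [l Ml El]] [iF [l' Ml' Fl']]; split; first exact: idemM.
  have [a [b [la lb e Ma]]] := bs_directed bM Ml Ml'.
  exists (cmp l a) => //; apply/dom_mul => //; split; first exact: dom_extend.
  by rewrite e; exact: dom_extend.
- move=> E F [iE [l Ml El]] iF EF; split=> //; exists l => //.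
  by move/(idem_le_dom iE iF) : EF; apply.
- by move=> [_ [l _ /dom_zero]].
- move=> E Z [iE [a Ma Ea]] fZ iZ cZ.
  (* The test set consists of the sources of all triples in the cover. For each extension [cmp a y],
     the nonzero idempotent [vsingle (cmp a y)] lies below [E], so it meets a member of the cover
     and [cmp a y] is compatible with one of these sources. *)
  have [||z [z' Zz' [mu [g H]]] Mz] := bs_meet bM Ma
    (X := \bigcup_(F in Z) [set nu | exists mu g, SGL_val F (mu, g, nu)]).
  + by apply: bigcup_finite => // F _; exact: finite_sources.
  + move=> y ay; have Ey : dom E (cmp a y) by exact: dom_extend.
    have ie := vsingle_idem (cmp a y).
    have [F [ZF nF]] : exists F, Z F /\ vsingle (cmp a y) * F <> iszero S.
      apply: contrapT => nF; apply: (@dom_zero (cmp a y)).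
      rewrite -(cZ _ ie); first exact: dom_vsingle_self.
        exact/vsingle_le.
      by move=> F ZF; apply: contrapT => H; apply: nF; exists F.
    have [l Hl] : exists l, dom (vsingle (cmp a y) * F : S) l.
      by apply: contrapT => H; apply: nF; apply: eq_zero_dom => l Hl; apply: H; exists l.
    have iF := iZ _ ZF.
    have [/dom_vsingle[u yu E1] [mu [g [nu [w [H nw E2]]]]]] := (dom_mul l ie iF).1 Hl.
    exists nu; first by exists F => //; exists mu, g.
    by exists u, w; rewrite -E1 -E2.
  exists z' => //; split; first exact: iZ.
  by exists z => //; exact: dom_prefix H.
Qed.

(** An idempotent [E] is covered by the finitely many [vsingle nu] with [nu] a source of its
    triples; the cover condition selects one. *)
Lemma tight_triple (F : set S) E : tight_set F -> F E ->
  exists2 l, SGL_val E (l, 1%g, l) & F (vsingle l).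
Proof.
move=> tF FE; have iE := ts_idem tF FE.
have [|||_ [nu [mu [g H]] <-] Fnu] := ts_cover tF FE
  (X := vsingle @` [set nu | exists mu g, SGL_val E (mu, g, nu)]).
- exact/finite_image/finite_sources.
- by move=> _ [l _ <-]; exact: vsingle_idem.
- move=> f jf fE fX; apply: eq_zero_dom => l fl.
  have := (idem_le_dom jf iE).1 fE _ fl.
  move=> [mu [g [nu [y [H ny E1]]]]]; apply: (@dom_zero l).
  rewrite -(fX (vsingle nu)); last by exists nu => //; exists mu, g.
  apply/dom_mul => //; first exact: vsingle_idem.
  by split=> //; apply/dom_vsingle; exists y.
by have [? ?] := idem_triple iE H; subst mu g; exists nu.
Qed.

Lemma tight_boundary_set (F : set S) : tight_set F ->
  boundary_set [set l | F (vsingle l)].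
Proof.
move=> tF; split.
- have [E FE] := ts_neq0 tF; have [l _ Fl] := tight_triple tF FE.
  by exists l.
- move=> a b ab /= Fab; apply: (ts_up tF Fab (vsingle_idem a)).
  by apply/vsingle_le; [exact: vsingle_idem|apply/dom_vsingle; exists b].
- move=> a b /= Fa Fb; have [l H Fl] := tight_triple tF (ts_mul tF Fa Fb).
  have [] := (dom_mul l (vsingle_idem a) (vsingle_idem b)).1 (dom_prefix H).
  move=> /dom_vsingle[a' aa Ea] /dom_vsingle[b' bb Eb].
  by exists a', b'; rewrite -Ea -Eb.
(* [HX] says that the idempotents [vsingle mu], for [mu] in [X], cover [vsingle a]. *)
- move=> a X /= Fa fX HX.
  have [|||_ [mu Xmu <-] Fmu] := ts_cover tF Fa (X := vsingle @` X).
  + exact: finite_image.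
  + by move=> _ [l _ <-]; exact: vsingle_idem.
  + move=> f jf fa fX0; apply: eq_zero_dom => l fl.
    have /dom_vsingle[y ay El] := (idem_le_dom jf (vsingle_idem a)).1 fa _ fl.
    have [mu Xmu [u [w [yu mw E]]]] := HX y ay; rewrite -El in yu E.
    apply: (@dom_zero (cmp l u)); rewrite -(fX0 (vsingle mu)); last by exists mu.
    apply/dom_mul => //; first exact: vsingle_idem.
    by split; [exact: dom_extend|rewrite E; apply/dom_vsingle; exists w].
  by exists mu.
Qed.

Lemma tight_dom_filter (F : set S) : tight_set F ->
  F = dom_filter [set l | F (vsingle l)].
Proof.
move=> tF; apply/seteqP; split=> E.
  move=> FE; have [l H Fl] := tight_triple tF FE.
  by split; [exact: (ts_idem tF)|exists l => //; exact: dom_prefix H].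
by move=> [iE [l /= Fl El]]; apply: (ts_up tF Fl iE); exact/vsingle_le.
Qed.

Lemma SGL_filterE (x : prepath L) : boundary_set (path_set x) ->
  SGL_filter A x = dom_filter (path_set x).
Proof.
move=> bx; apply/seteqP; split=> E.
  move=> [iE [n nx H]]; apply/dom_filterE => //.
  by exists (pmor x dg0 n) => //; exists n.
move=> FE; have iE : idem E by case: FE.
have [_ [n nx ->] H] := (dom_filterE bx iE).1 FE.
by split=> //; exists n.
Qed.

Lemma single_dom mu g nu (h : sc mu = act g (sc nu)) :
  isstar (SGL_single h : S) * SGL_single h = vsingle nu.
Proof.
apply: SGL_rho_inj; rewrite SGL_rhoE SGL_rho_star.
apply: pbijP => c c'; split=> [[d Hd Hd']|H].
  have ? : c = c' := pb_inj Hd Hd'; subst c'.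
  have /dom_single[y ny Ec] := SGL_rho_dom Hd.
  rewrite [c]surjective_pairing; apply: idem_rho; first exact: vsingle_idem.
  by apply/dom_vsingle; exists y.
have ? := pbidem_id (SGL_rho_idem (vsingle_idem nu)) H; subst c'.
have /dom_vsingle[y ny Ec] := SGL_rho_dom H.
have D : dom (SGL_single h) c.1 by apply/dom_single; exists y.
have [d Hd] := dom_SGL_rho c.2 D.
by exists d; rewrite [c]surjective_pairing.
Qed.

Lemma mul_vsingle E mu g nu (h : sc mu = act g (sc nu)) :
  SGL_val E (mu, g, nu) -> E * vsingle nu = SGL_single h.
Proof.
move=> H; rewrite -(single_dom h); apply: SGL_rho_inj.
rewrite !SGL_rhoE SGL_rho_star; apply: pbcomp_restrict.
move=> c c' [mu' [g' [nu' [y [[-> -> ->] H1 H2 H3]]]]].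
by exists mu, g, nu, y.
Qed.

Lemma dom_starl E l : dom (isstar E * E : S) l -> dom E l.
Proof.
by move=> /(dom_SGL_rho 1%g)[c]; rewrite SGL_rhoE => -[d /SGL_rho_dom].
Qed.

(** * Embedding the semigroup of the Zappa-Szep product into [SGL] *)

Local Notation Z := (zappaSzep A).
Local Notation T := (SC Z).

Definition tau_sigma (t : triple L G) : T :=
  @tau Z (t.1.1, t.1.2) * @sigma Z (t.2, 1%g).

Lemma tau_sigmaE mu g nu (h : sc mu = act g (sc nu)) :
  SC_val (tau_sigma (mu, g, nu)) = SGL_rho (SGL_single h) :> pbij (L * G).
Proof.
apply: pbijP => -[l i] c'; split.
  move=> [[y j]] /= [[e1] [e2 e3]] [_ ->].
  rewrite invg1 !act1 in e1 e2; rewrite coc1 mul1g in e3; subst j.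
  by exists mu, g, nu, y.
move=> [mu' [g' [nu' [y [[-> -> ->] ny /= -> ->]]]]].
exists (y, i) => /=; split.
- by rewrite /zs_sc /zs_rg /= invg1 act1 ny.
- by rewrite /zs_cmp /= act1 coc1 mul1g.
- by rewrite /zs_sc /zs_rg /= h actK ny.
- by [].
Qed.

Lemma in_SC_SGL (f : pbij Z) : in_SC f -> exists E : S, SGL_rho E = f.
Proof.
have tauP (a : Z) : exists E : S, SGL_rho E = tau_pb a.
  (* The triple for tau^(mu, g) is (mu, g, v), with [v] the vertex that is the source of (mu, g). *)
  case: a => mu g; have h : sc mu = act g (sc (act g^-1%g (sc mu))).
    by rewrite sc_act actKV sc_sc.
  exists (SGL_single h); rewrite -tau_sigmaE; apply: pbijP => -[l i] c'; split.
    move=> [[y j]] /= [[e1] [e2 e3]] [_ ->].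
    rewrite invg1 !act1 sc_act sc_sc in e1 e2; rewrite coc1 mul1g in e3; subst j.
    by rewrite e2 e1 cmp_rg; split=> //; rewrite /zs_sc /zs_rg /= e1.
  move=> /= [[e] ->]; exists (l, i); split=> //=.
  - by rewrite /zs_sc /zs_rg /= invg1 act1 sc_act sc_sc e.
  - by rewrite /zs_cmp /= act1 e coc1 mul1g cmp_rg.
  - by rewrite /zs_sc /zs_rg /= e.
elim=> {f} [a|a||f g _ [E Ef] _ [F Fg]|f _ [E Ef]].
- exact: tauP.
- by have [E HE] := tauP a; exists (isstar E); rewrite SGL_rho_star HE.
- by exists (iszero S); rewrite (SGL_rho0 A : SGL_rho (iszero S) = _).
- by exists (E * F : S); rewrite SGL_rhoE Ef Fg.
- by exists (isstar E); rewrite SGL_rho_star Ef.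
Qed.

Lemma SC_embedding : exists j : T -> S, forall f, SGL_rho (j f) = SC_val f.
Proof.
have /choice[j jP] : forall f : T, exists E : S, SGL_rho E = SC_val f.
  by move=> f; exact: in_SC_SGL (SC_valP f).
by exists j.
Qed.

Section Embedding.
Variable j : T -> S.
Hypothesis jP : forall f, SGL_rho (j f) = SC_val f.

Lemma embedding_inj : injective j.
Proof.
move=> f g /(congr1 (@SGL_rho _ _ _ A)); rewrite !jP.
exact: (@SC_val_inj Z).
Qed.

Lemma embedding_mul f g : j (f * g) = j f * j g.
Proof. by apply: SGL_rho_inj; rewrite SGL_rhoE !jP. Qed.

Lemma embedding_star f : j (isstar f) = isstar (j f).
Proof. by apply: SGL_rho_inj; rewrite SGL_rho_star !jP. Qed.

Lemma embedding_zero : j (iszero T) = iszero S.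
Proof. by apply: SGL_rho_inj; rewrite jP (SGL_rho0 A : SGL_rho (iszero S) = _). Qed.

Lemma embedding_tau_sigma mu g nu (h : sc mu = act g (sc nu)) :
  j (tau_sigma (mu, g, nu)) = SGL_single h.
Proof. by apply: SGL_rho_inj; rewrite jP tau_sigmaE. Qed.

(** Each triple of [s] is a restriction of [s] and comes from [tau_sigma]; every point of the domain
    of [s] extends the source of some triple. *)
Lemma embedding_dense (s : S) : exists X : set T, [/\ finite_set X,
  forall t, X t -> s * j (isstar t * t) = j t
  & covers ((fun t => j (isstar t * t)) @` X) (isstar s * s)].
Proof.
have [fs hs _] := SGL_valP s.
exists (tau_sigma @` SGL_val s); split; first exact: finite_image.
- move=> _ [[[mu g] nu] H <-]; rewrite embedding_mul embedding_star.
  by rewrite (embedding_tau_sigma (hs _ _ _ H)) single_dom; exact: mul_vsingle.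
- move=> f jf fs' fX; apply: eq_zero_dom => l fl.
  have [mu [g [nu [y [H ny E]]]]] :=
    dom_starl ((idem_le_dom jf (idem_starl s)).1 fs' _ fl).
  apply: (@dom_zero l); rewrite -(fX (vsingle nu)).
    apply/dom_mul => //; first exact: vsingle_idem.
    by split=> //; apply/dom_vsingle; exists y.
  exists (tau_sigma (mu, g, nu)); first by exists (mu, g, nu).
  by rewrite embedding_mul embedding_star (embedding_tau_sigma (hs _ _ _ H)) single_dom.
Qed.

(** Both filters ask that the idempotent be defined at some initial segment of [x], and [j]
    preserves the underlying partial bijection. *)
Lemma zs_filterE (x : prepath L) : boundary_set (path_set x) ->
  j @^-1` SGL_filter A x = zs_filter A x.
Proof.
move=> bx; rewrite SGL_filterE //; apply/seteqP; split=> f /=.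
- move=> [ijf [_ [n nx ->] /(dom_SGL_rho 1%g)[c]]]; rewrite jP => H.
  split; last by exists n => //; exists c.
  by apply: embedding_inj; rewrite embedding_mul.
- move=> [jf [n nx [c]]]; rewrite -jP => /SGL_rho_dom H.
  split; first exact: etrans (esym (embedding_mul f f)) (congr1 j jf).
  by exists (pmor x dg0 n) => //; exists n.
Qed.

End Embedding.
End SelfSimilarTight.

Theorem proposition6p4 (k : nat) (Lam : kgraph k) (G : groupType)
    (A : selfSimilar Lam G) :
  exists Phi : tightGroupoid (SGL A) -> tightGroupoid (SC (zappaSzep A)),
    [/\ forall (mu nu : Lam) (g : G) (h : sc mu = act A g (sc nu))
            (x : prepath Lam),
          boundary_path x -> path_range x = sc nu ->
          exists (c : tightGroupoid (SGL A))
                 (d : tightGroupoid (SC (zappaSzep A))),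
            [/\ is_germ c (SGL_single h) (SGL_filter A (path_concat nu x)),
                is_germ d (ismul (@tau (zappaSzep A) (mu, g))
                                 (@sigma (zappaSzep A) (nu, 1%g)))
                          (zs_filter A (path_concat nu x))
              & Phi c = d],
        forall c : tightGroupoid (SGL A),
          exists (mu nu : Lam) (g : G) (h : sc mu = act A g (sc nu))
                 (x : prepath Lam),
            [/\ boundary_path x, path_range x = sc nu
              & is_germ c (SGL_single h) (SGL_filter A (path_concat nu x))]
      & tightGroupoid_iso Phi].
Proof.
have fa := ss_finitely_aligned A.
have [j jP] := SC_embedding A.
have [Phi [PhiP Phi_iso]] := dense_subsemigroup_iso (embedding_inj jP)
  (embedding_mul jP) (embedding_star jP) (embedding_zero jP) (embedding_dense jP).
exists Phi; split=> //.
- move=> mu nu g h x bx xnu; have [px _] := bx.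
  have bM := boundary_path_set fa bx.
  have nM m : path_set x m -> sc nu = rg m by move=> [n nx ->]; rewrite path_rangeE.
  have EM := path_set_concat px xnu.
  have bC : boundary_set (path_set (path_concat nu x)).
    by rewrite EM; exact: boundary_concat_set.
  have tF := boundary_set_tight A bC.
  have Cnu : path_set (path_concat nu x) nu.
    have [m Mm] := bs_neq0 bM; rewrite EM; exists m, m; split=> //; exact: nM.
  have Fh : SGL_filter A (path_concat nu x)
      (ismul (isstar (SGL_single h : SGL A)) (SGL_single h)).
    by rewrite single_dom SGL_filterE //; apply/dom_filter_vsingle.
  have [|c gc] := is_germ_ex _ Fh; first by apply/is_tightP; rewrite SGL_filterE.
  exists c, (Phi c); split=> //; rewrite -(zs_filterE jP bC).
  by apply: PhiP; rewrite (embedding_tau_sigma jP h).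
- move=> c; have [s [F [tF' Fs E]]] := germ_valP c.
  have gc : is_germ c s F by [].
  have /is_tightP tF := tF'.
  (* The segment [l] lies in the domain of [s] through one triple, whose source [nu] is a prefix of
     [l]. Hence [F] contains [vsingle nu], on which [s] agrees with that triple, and [x] is
     recovered by removing [nu]. *)
  have [l H Fl] := tight_triple tF Fs.
  have [mu [g [nu [y [Hs ny El]]]]] := dom_starl (dom_prefix H).
  have [_ /(_ _ _ _ Hs) h _] := SGL_valP s.
  have Fnu : F (vsingle A nu).
    apply: (ts_up tF Fl (vsingle_idem A nu)).
    by apply/vsingle_le; [exact: vsingle_idem|apply/dom_vsingle; exists y].
  have bM := tight_boundary_set tF; have bN := boundary_shift_set bM Fnu.
  have [|x [bx xnu EM]] := @boundary_set_path _ _ _ (sc nu) bN.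
    by move=> m [].
  have [px _] := bx.
  have EC : path_set (path_concat nu x) = [set l | F (vsingle A l)].
    by rewrite (path_set_concat px xnu) EM concat_shift_set.
  exists mu, nu, g, h, x; split=> //.
  rewrite SGL_filterE EC // -(tight_dom_filter tF).
  apply: (is_germ_rep gc Fnu).
  by rewrite (mul_vsingle h Hs) -(single_dom h) ismulA ismul_star.
Qed.
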